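(* Let $X$ be a closed subspace of $L_1[0,1]$. If every spreading model of $X$ is equivalent to the unit vector basis of $\ell_1$, then $X$ has the Lebesgue property.
   Context: $L_1[0,1]$ is taken with Lebesgue measure and its usual norm. Riemann integrability. A partition of $[0,1]$ is a finite strictly increasing sequence $P=(p_i)_{i=0}^d$ with $p_0=0$, $p_d=1$; its mesh is $\pi(P)=\max_{1\le i\le d}(p_i-p_{i-1})$. A tagged partition is a pair $(P,T)$ with $T=(t_i)_{i=1}^d$ and $t_i\in[p_{i-1},p_i]$. For $f:[0,1]\to X$ put $S_f(P,T)=\sum_{i=1}^d (p_i-p_{i-1})f(t_i)$. The function $f$ is Riemann-integrable if there is $x_f\in X$ such that for every $\varepsilon>0$ there is $\delta>0$ with $\|x_f-S_f(P,T)\|<\varepsilon$ for every tagged partition $(P,T)$ with $\pi(P)<\delta$. Lebesgue property. A Banach space $X$ has the Lebesgue property if every Riemann-integrable function $f:[0,1]\to X$ is continuous at Lebesgue almost every point of $[0,1]$. Basic sequence. A sequence is basic if it is a Schauder basis of its closed linear span; normalized means all its vectors have norm one. Spreading model. Let $(e_i)$ be a normalized basic sequence in $X$ and let $(v_i)$ be a normalized Schauder basis of a Banach space $(V,\|\cdot\|_V)$. If there exist positive reals $\delta_n\searrow 0$ such that for every $n\in\mathbb{N}$ $$\left|\,\left\|\sum_{j=1}^n a_je_{i_j}\right\|-\left\|\sum_{i=1}^n a_iv_i\right\|_V\right|<\delta_n$$ for all integers $n\le i_1<\dots<i_n$ and all scalars $(a_i)_{i=1}^n$ with $|a_i|\le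 1$, then $(v_i)$ is called a spreading model of $X$ generated by $(e_i)$. Equivalence. Basic sequences $(e_i)$ and $(e_i')$ are equivalent if there is $C>0$ such that $\frac1C\|\sum_{i=1}^n a_ie_i'\|\le\|\sum_{i=1}^n a_ie_i\|\le C\|\sum_{i=1}^n a_ie_i'\|$ for every $n\in\mathbb{N}$ and all scalars $(a_i)$. *)

(* Defs.v *)
From HB Require Import structures.
From mathcomp Require Import all_boot all_order all_algebra generic_quotient.
From mathcomp Require Import all_classical all_reals all_analysis ess_sup_inf measurable_realfun.
Set Implicit Arguments.
Unset Strict Implicit.
Unset Printing Implicit Defensive.
Import Order.TTheory GRing.Theory Num.Theory.
Import numFieldNormedType.Exports.
Local Open Scope classical_set_scope.
Local Open Scope ring_scope.

(* The library's Lspace is a bare type of almost-everywhere classes with finite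
   L^p norm; the instances below make it a normed module over R for that norm. *)
Section Lspace_normedModType.
Context d (T : measurableType d) (R : realType).
Variables (mu : {measure set T -> \bar R}) (p : \bar R) (p1 : (1 <= p)%E).
Local Notation Lp := (LspaceType mu p1).
Local Notation Lf := (LfunType mu p1).
Local Notation quo := ({mfun_ mu, T >-> measurableTypeR R}).
Implicit Types (u v : Lp) (f g : Lf).

Lemma ae_eq_Lnorm (f g : {mfun T >-> R}) : f = g %[ae mu] ->
  ('N[mu]_p[EFin \o f] = 'N[mu]_p[EFin \o g])%E.
Proof.
move=> fg; rewrite unlock; case: p p1 => [r r1|_|]//; last first.
  case: ifPn => // mu0; apply: eq_ess_sup.
  by apply: filterS fg => x /(_ I) /= ->.
congr poweR; apply: ae_eq_integral => //=.
- apply/measurable_EFinP.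
  apply: (measurableT_comp (measurable_powR _)) => //.
  exact: measurableT_comp.
- apply/measurable_EFinP.
  apply: (measurableT_comp (measurable_powR _)) => //.
  exact: measurableT_comp.
- by apply: filterS fg => x /(_ I) /= ->.
Qed.

(* R and measurableTypeR R carry the same measurable sets but are distinct
   instances; LfunType uses the former and LspaceType the latter. *)
Lemma mfunR_subproof f :
  measurable_fun [set: T] (f : T -> measurableTypeR R).
Proof. exact: (@measurable_funPT _ _ _ _ f). Qed.

Definition mfunR f : {mfun T >-> measurableTypeR R} :=
  HB.pack (f : T -> measurableTypeR R)
    (isMeasurableFun.Build _ _ _ _ _ (mfunR_subproof f)).

Definition quo_class f : quo := \pi_quo%qT (mfunR f).

Lemma quo_classP f : (quo_class f : T -> R) = f %[ae mu].
Proof.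
have /eqmodP /asboolP // : (repr (\pi_quo (mfunR f)) = mfunR f %[mod quo])%qT.
by rewrite reprK.
Qed.

Lemma quo_mfun (q : quo) : (q : T -> R) \in mfun.
Proof. by rewrite inE; exact: (@measurable_funPT _ _ _ _ (repr q)). Qed.

Lemma Lclass_finite f : finite_norm mu p (quo_class f).
Proof.
rewrite /finite_norm (@ae_eq_Lnorm (mfun_Sub (quo_mfun (quo_class f))) f).
  exact: Lfunction_finite.
exact: quo_classP.
Qed.

Definition Lclass f : Lp :=
  HB.pack (quo_class f)
    (isFinLebesgue.Build d T R mu p p1 _ (Lclass_finite f)).

Lemma Lrepr_Lfun u : (u : T -> R) \in Lfun mu p.
Proof.
apply/andP; split; first exact: quo_mfun.
by rewrite inE; exact: Lebesgue_finite.
Qed.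

Definition Lrepr u : Lf := Lfun_Sub p1 (Lrepr_Lfun u).

Lemma LreprE u : Lrepr u = u :> (T -> R).
Proof. by []. Qed.

Lemma Lclass_ae f : Lrepr (Lclass f) = f %[ae mu].
Proof. exact: quo_classP. Qed.

Lemma Lp_eqP u v : u = v <-> Lrepr u = Lrepr v %[ae mu].
Proof.
split=> [->|uv]; first exact: ae_eq_refl.
have : (u : quo) = v.
  by rewrite -[LHS]reprK -[RHS]reprK; apply/eqmodP/asboolP.
case: u v {uv} => [u [[uf]]] [v [[vf]]] /= uv.
by case: _ / uv vf => vf; rewrite (Prop_irrelevance uf vf).
Qed.

Lemma Lclass_eqP f g : Lclass f = Lclass g <-> f = g %[ae mu].
Proof.
rewrite Lp_eqP; split=> fg.
  exact: ae_eq_trans (ae_eq_sym (Lclass_ae f)) (ae_eq_trans fg (Lclass_ae g)).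
exact: ae_eq_trans (Lclass_ae f) (ae_eq_trans fg (ae_eq_sym (Lclass_ae g))).
Qed.

Lemma LreprK u : Lclass (Lrepr u) = u.
Proof. by apply/Lp_eqP; exact: Lclass_ae. Qed.

HB.instance Definition _ := gen_eqMixin Lp.
HB.instance Definition _ := gen_choiceMixin Lp.

Definition Lp_zero : Lp := Lclass 0.
Definition Lp_opp u : Lp := Lclass (- Lrepr u).
Definition Lp_add u v : Lp := Lclass (Lrepr u + Lrepr v).
Definition Lp_scale (a : R) u : Lp := Lclass (a *: Lrepr u).

Lemma Lp_oppE f : Lp_opp (Lclass f) = Lclass (- f).
Proof.
apply/Lclass_eqP; apply: filterS (Lclass_ae f) => x e xT.
exact: (congr1 (@GRing.opp R) (e xT)).
Qed.

Lemma Lp_addE f g : Lp_add (Lclass f) (Lclass g) = Lclass (f + g).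
Proof.
apply/Lclass_eqP; apply: filterS2 (Lclass_ae f) (Lclass_ae g) => x /= e e' xT.
exact: (congr2 +%R (e xT) (e' xT)).
Qed.

Lemma Lp_scaleE a f : Lp_scale a (Lclass f) = Lclass (a *: f).
Proof.
apply/Lclass_eqP; apply: filterS (Lclass_ae f) => x e xT.
exact: (congr1 ( *%R a) (e xT)).
Qed.

Lemma Lp_addA : associative Lp_add.
Proof.
move=> u v w; rewrite -[u]LreprK -[v]LreprK -[w]LreprK.
by rewrite !Lp_addE addrA.
Qed.

Lemma Lp_addC : commutative Lp_add.
Proof. by move=> u v; rewrite /Lp_add addrC. Qed.

Lemma Lp_add0 : left_id Lp_zero Lp_add.
Proof. by move=> u; rewrite -[u]LreprK Lp_addE add0r. Qed.

Lemma Lp_addN : left_inverse Lp_zero Lp_opp Lp_add.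
Proof. by move=> u; rewrite -[u]LreprK Lp_oppE Lp_addE addNr. Qed.

HB.instance Definition _ :=
  GRing.isZmodule.Build Lp Lp_addA Lp_addC Lp_add0 Lp_addN.

Lemma Lp_scaleA a b u : Lp_scale a (Lp_scale b u) = Lp_scale (a * b) u.
Proof. by rewrite -[u]LreprK !Lp_scaleE scalerA. Qed.

Lemma Lp_scale1 : left_id 1 Lp_scale.
Proof. by move=> u; rewrite /Lp_scale scale1r LreprK. Qed.

Lemma Lp_scaleDr : right_distributive Lp_scale +%R.
Proof.
move=> a u v; rewrite -[u]LreprK -[v]LreprK.
move: (Lrepr u) (Lrepr v) => f g.
transitivity (Lp_scale a (Lclass (f + g))); first by congr Lp_scale; exact: Lp_addE.
transitivity (Lp_add (Lclass (a *: f)) (Lclass (a *: g))).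
  by rewrite (Lp_scaleE a (f + g)) (Lp_addE (a *: f)) scalerDr.
by rewrite -!Lp_scaleE.
Qed.

Lemma Lp_scaleDl u : {morph Lp_scale^~ u : a b / a + b}.
Proof.
move=> a b /=; rewrite -[u]LreprK; move: (Lrepr u) => f.
transitivity (Lp_add (Lclass (a *: f)) (Lclass (b *: f))).
  by rewrite (Lp_scaleE (a + b) f) (Lp_addE (a *: f)) scalerDl.
by rewrite -!Lp_scaleE.
Qed.

HB.instance Definition _ := GRing.Zmodule_isLmodule.Build R Lp
  Lp_scaleA Lp_scale1 Lp_scaleDr Lp_scaleDl.

Definition Lp_norm u : R := fine 'N[mu]_p[EFin \o (u : T -> R)].

Lemma Lp_normE f : Lp_norm (Lclass f) = fine 'N[mu]_p[EFin \o f].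
Proof. by congr fine; exact: ae_eq_Lnorm (Lclass_ae f). Qed.

Lemma Lp_ler_normD u v : Lp_norm (u + v) <= Lp_norm u + Lp_norm v.
Proof.
rewrite -[u]LreprK -[v]LreprK; move: (Lrepr u) (Lrepr v) => f g.
by rewrite [X in Lp_norm X](Lp_addE f g) !Lp_normE; exact: ler_LnormD.
Qed.

Lemma Lp_normZ a u : Lp_norm (a *: u) = `|a| * Lp_norm u.
Proof.
rewrite -[u]LreprK; move: (Lrepr u) => f.
rewrite [X in Lp_norm X](Lp_scaleE a f) !Lp_normE.
apply: EFin_inj; rewrite finite_norm_fine EFinM finite_norm_fine.
exact: LnormZ.
Qed.

Lemma Lp_norm0_eq0 u : Lp_norm u = 0 -> u = 0.
Proof.
rewrite -[u]LreprK Lp_normE => /fine_Lnormr_eq0 u0.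
exact/Lclass_eqP.
Qed.

HB.instance Definition _ :=
  Lmodule_isNormed.Build R Lp Lp_ler_normD Lp_normZ Lp_norm0_eq0.

End Lspace_normedModType.

(* Classes of functions on the whole line modulo equality almost everywhere
   on [0, 1], i.e., L^1 for the restriction of Lebesgue measure to [0, 1]. *)
Definition lebesgue01 (R : realType) : {measure set (measurableTypeR R) -> \bar R} :=
  mrestr lebesgue_measure (measurable_itv `[0%R, 1%R]%R).

Definition L1_01 (R : realType) : normedModType R := LspaceType1 (lebesgue01 R).

Section ell1.
Variable R : realType.

Definition ell1 : normedModType R := LspaceType1 (@counting nat R).

Lemma ell1_unit_Lfun (n : nat) : (\1_[set n] : nat -> R) \in Lfun counting 1.
Proof.
apply/andP; split; rewrite inE/=; first exact: measurable_indic.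
rewrite /finite_norm Lnorm1; under eq_integral.
  by move=> k _; rewrite /= ger0_norm//; over.
rewrite integral_indic// setIT /= /counting asboolT ?ltry//.
Qed.

Definition ell1_unit (n : nat) : ell1 :=
  Lclass (Lfun_Sub (@lexx _ _ 1%E) (ell1_unit_Lfun n)).

Lemma ell1_unit_norm (n : nat) (a : nat -> R) :
  `|\sum_(i < n) a i *: ell1_unit i| = \sum_(i < n) `|a i|.
Proof.
pose f := \sum_(i < n) a i *: Lfun_Sub (@lexx _ _ 1%E) (ell1_unit_Lfun i).
have -> : \sum_(i < n) a i *: ell1_unit i = Lclass f.
  rewrite /f; apply: (big_ind2 (fun x y => x = Lclass y)) => //.
  - by move=> x f1 y f2 -> ->; exact: Lp_addE.
  - by move=> i _; exact: Lp_scaleE.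
have fE k : f k = if (k < n)%N then a k else 0.
  transitivity (\sum_(i < n) a i * \1_[set (i : nat)] k).
    by rewrite /f; apply: (big_ind2 (fun (x : LfunType _ _) y => x k = y))
      => // x1 y1 x2 y2 <- <-.
  case: ifPn => kn; last first.
    rewrite big1// => i _; rewrite indicE memNset ?mulr0// => /= ki.
    by move: kn; rewrite ki ltn_ord.
  rewrite (bigD1 (Ordinal kn))//= indicE mem_set//= mulr1 big1 ?addr0// => i.
  rewrite -val_eqE /= => ik; rewrite indicE memNset ?mulr0// => /= ki.
  by rewrite ki eqxx in ik.
rewrite [LHS]Lp_normE Lnorm1 ge0_integral_count//=.
rewrite (nneseries_split 0 n)//= eseries0; last first.
  by move=> i + _; rewrite add0n fE ltnNge => -> /=; rewrite normr0.
rewrite adde0 add0n sumEFin /= big_mkord; apply: eq_bigr => i _.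
by rewrite fE ltn_ord.
Qed.
End ell1.

Section banach_sequences.
Context (R : realType).

Definition linear_span (E : normedModType R) (e : nat -> E) : set E :=
  [set x | exists n (a : nat -> R), x = \sum_(i < n) a i *: e i].

(* Y is meant to be a closed linear subspace of a Banach space. *)
Definition schauder_basis (E : normedModType R) (Y : set E) (e : nat -> E) :=
  (forall i, Y (e i)) /\
  (forall x, Y x ->
    exists! a : nat -> R, (fun n => \sum_(i < n) a i *: e i) @ \oo --> x).

Definition basic_sequence (E : normedModType R) (e : nat -> E) :=
  schauder_basis (closure (linear_span e)) e.

Definition normalized_seq (E : normedModType R) (e : nat -> E) :=
  forall i, `|e i| = 1.

(* Sequences are indexed from 0, so the n-tuple i stands for the indices
   (i j).+1 >= 1, all at least n; the additional case n = 0 is void. *)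
Definition generates_spreading_model (E V : normedModType R)
    (e : nat -> E) (v : nat -> V) :=
  exists delta : nat -> R,
    [/\ forall n, 0 < delta n,
        nonincreasing_seq delta,
        delta @ \oo --> 0 &
        forall (n : nat) (i : 'I_n -> nat) (a : 'I_n -> R),
          (forall j, n <= (i j).+1)%N ->
          {homo i : j k / (j < k)%N} ->
          (forall j, `|a j| <= 1) ->
          `| `|\sum_j a j *: e (i j)| - `|\sum_j a j *: v j| | < delta n].

Definition spreading_model (E : normedModType R) (X : set E)
    (V : completeNormedModType R) (v : nat -> V) :=
  [/\ normalized_seq v, schauder_basis setT v &
    exists e : nat -> E,
      [/\ forall i, X (e i), normalized_seq e, basic_sequence e &
          generates_spreading_model e v]].

Definition equivalent_sequences (E F : normedModType R)
    (e : nat -> E) (f : nat -> F) :=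
  exists2 C : R, 0 < C &
    forall (n : nat) (a : nat -> R),
      C^-1 * `|\sum_(i < n) a i *: f i| <= `|\sum_(i < n) a i *: e i|
      /\ `|\sum_(i < n) a i *: e i| <= C * `|\sum_(i < n) a i *: f i|.

End banach_sequences.

Section riemann.
Context (R : realType) (E : normedModType R).
Implicit Types (X : set E) (f : R -> E) (s : seq R) (t : nat -> R).

(* A partition of [0, 1] is 0 :: s with itv_partition 0 1 s; the tag of its
   i-th interval [node s i, node s i.+1] is t i, and t i is irrelevant for
   i >= size s. *)
Definition node s (i : nat) : R := nth 0 (0 :: s) i.

Definition mesh s : R :=
  \big[Num.max/0]_(i < size s) (node s i.+1 - node s i).

Definition tagged_partition s t :=
  itv_partition 0 1 s /\
  forall i, (i < size s)%N -> node s i <= t i <= node s i.+1.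

Definition riemann_sum f s t : E :=
  \sum_(i < size s) (node s i.+1 - node s i) *: f (t i).

(* f stands for a function from [0, 1] to the subspace X: its values outside
   [0, 1] are irrelevant, and continuity is relative to [0, 1]. *)
Definition riemann_integrable X f :=
  exists2 x, X x &
    forall eps : R, 0 < eps -> exists2 delta : R, 0 < delta &
      forall s t, tagged_partition s t -> mesh s < delta ->
        `|x - riemann_sum f s t| < eps.

Definition lebesgue_property X :=
  forall f, (forall x, x \in `[0, 1] -> X (f x)) ->
    riemann_integrable X f ->
    {ae lebesgue_measure, forall x : R, x \in `[0, 1] ->
      f y @[y --> within `[0, 1] (nbhs x)] --> f x}.

End riemann.

(* Main.v *)
(* Fix f Riemann integrable. Call t bad when, for some c > 0, every S in the space
   and every neighbourhood of t admit t' with max(|S + u|, |S - u|) >= |S| + c,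
   where u = f(t') - f(t). In a fine uniform partition, choosing tags cell by cell
   makes two Riemann sums differ by at least c times the number of cells meeting
   the bad set, so the bad set is null. Apply this to f, where
   |S + u| + |S - u| = 2 int max(|S|, |u|) turns goodness into equi-integrability
   of the increments u, and to the scalar functions phi o f with phi in a countable
   norming family, where it says that phi(u) -> 0. If f is discontinuous at a point
   which is good for all of these, normalized increments along an ultrafilter are
   equi-integrable and asymptotically transversal to each vector. The
   Brunel-Sucheston construction, with iterated limits along the ultrafilter in
   place of Ramsey's theorem, extracts a basic sequence generating a spreading
   model. Choosing signs that make the truncated sums small in L^2 yields
   combinations of norm o(n) of any n terms with coefficients +-1, so that this
   spreading model is not equivalent to the basis of l^1. *)
Require Import Defs.
From HB Require Import structures.
From mathcomp Require Import all_boot all_order all_algebra.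
From mathcomp Require Import all_classical all_reals all_analysis.
From mathcomp Require Import measurable_realfun.
From mathcomp Require Import ring lra.
Set Implicit Arguments.
Unset Strict Implicit.
Unset Printing Implicit Defensive.
Import Order.TTheory GRing.Theory Num.Theory.
Import numFieldNormedType.Exports.
Local Open Scope classical_set_scope.
Local Open Scope ring_scope.

(** * Limits along an ultrafilter *)

Section ultrafilter_limit.
Context (R : realType) (T : Type) (U : set_system T) {UF : UltraFilter U}.

(** The limit is the supremum of the [y] lying below [g] along [U]: the ultrafilter decides whether
    [g i < sup D + e], and a negative answer would put [sup D + e] in [D]. *)
Lemma ultra_bounded_cvg (g : T -> R) (M : R) :
  (\forall i \near U, `|g i| <= M) -> cvg (g @ U).
Proof.
move=> gM; pose D := [set y | \forall i \near U, y <= g i].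
have D0 : has_sup D.
  split; first by exists (- M); apply: filterS gM => i; rewrite ler_norml => /andP[].
  exists M => y Dy; have [i [/= yi]] := filter_ex (filterI Dy gM).
  by rewrite ler_norml => /andP[_]; exact: le_trans.
apply/cvg_ex; exists (sup D); apply/cvgrPdist_le => /= e e0.
have [y Dy ye] := sup_adherent e0 D0.
have : \forall i \near U, g i < sup D + e.
  have [//|] := in_ultra_setVsetC [set i | g i < sup D + e] UF.
  move=> h; have /(ub_le_sup D0.2) : D (sup D + e).
    by apply: filterS h => i /= /negP; rewrite -leNgt.
  by rewrite gerDl leNgt e0.
apply: filterS2 Dy => i yi ie; rewrite ler_distlC; apply/andP; split.
  by rewrite (le_trans (ltW ye)).
exact: ltW.
Qed.

(* A finite net of mesh 1/N in the cube reduces uniform convergence along U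
   to pointwise convergence. *)
Lemma uniform_near_cube (K : nat) (G : T -> (nat -> R) -> R)
    (H : (nat -> R) -> R) (eps : R) : 0 < eps ->
  (forall c, G i c @[i --> U] --> H c) ->
  (\forall i \near U, forall c c', `|G i c - G i c'| <= \sum_(j < K) `|c j - c' j|) ->
  (forall c c', `|H c - H c'| <= \sum_(j < K) `|c j - c' j|) ->
  \forall i \near U, forall c, (forall j, `|c j| <= 1) -> `|G i c - H c| <= eps.
Proof.
move=> e0 GH GL HL.
have [N N0 KN] : exists2 N : nat, (0 < N)%N & K%:R / N%:R <= eps / 4 :> R.
  exists (Num.truncn (K%:R / (eps / 4))).+1 => //.
  rewrite ler_pdivrMr ?ltr0n// mulrC -ler_pdivrMr ?divr_gt0//.
  exact/ltW/truncnS_gt.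
(* Net points have coordinates [g k / N - 1] in [-1, 1]. Coordinates from [K] on are set to 0, which
   the Lipschitz bounds do not see. *)
pose pt (g : {ffun 'I_K -> 'I_(2 * N).+1}) (j : nat) : R :=
  if insub j is Some k then (g k)%:R / N%:R - 1 else 0.
have near_pt : \forall i \near U,
    forall g : {ffun 'I_K -> 'I_(2 * N).+1}, `|G i (pt g) - H (pt g)| <= eps / 2.
  apply: filter_forall => g; have /cvgrPdist_le/(_ (eps / 2)) := GH (pt g).
  by rewrite divr_gt0// => /(_ isT); apply: filterS => i; rewrite distrC.
apply: filterS2 near_pt GL => i ptP Li c c1.
have cb j : (Num.truncn ((c j + 1) * N%:R) < (2 * N).+1)%N.
  have x0 : 0 <= (c j + 1) * N%:R.
    by rewrite mulr_ge0 // -lerBlDr sub0r; have := c1 j; rewrite ler_norml => /andP[].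
  move: (x0); rewrite -truncn_le ltnS -(ler_nat R) => /le_trans; apply.
  rewrite natrM ler_wpM2r// -lerBrDr; have := c1 j; rewrite ler_norml => /andP[_].
  by move=> /le_trans; apply; lra.
pose g : {ffun 'I_K -> 'I_(2 * N).+1} := [ffun j : 'I_K => Ordinal (cb j)].
have cg : \sum_(j < K) `|c j - pt g j| <= eps / 4.
  apply: le_trans KN;
  have -> : K%:R / N%:R = \sum_(j < K) N%:R^-1 :> R.
    by rewrite sumr_const card_ord mulr_natl.
  apply: ler_sum => j _; rewrite /pt insubT//= => jK.
  rewrite (_ : Sub _ _ = j); last exact: val_inj.
  rewrite /g ffunE /=.
  set x := (c j + 1) * N%:R.
  have x0 : 0 <= x.
    by rewrite mulr_ge0 // -lerBlDr sub0r; have := c1 j; rewrite ler_norml => /andP[].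
  have -> : c j - ((Num.truncn x)%:R / N%:R - 1) = (x - (Num.truncn x)%:R) / N%:R.
    by rewrite /x mulrBl mulfK ?pnatr_eq0 -?lt0n//; ring.
  have /andP[h1 h2] := truncn_itv x0.
  rewrite ger0_norm ?divr_ge0 ?subr_ge0// ler_pdivrMr ?ltr0n// mulVf ?pnatr_eq0 -?lt0n//.
  by rewrite -natr1 in h2; lra.
rewrite (_ : _ - _ = (G i c - G i (pt g)) + ((G i (pt g) - H (pt g)) + (H (pt g) - H c))); last by ring.
apply: (le_trans (ler_normD _ _)).
have h1 := le_trans (Li c (pt g)) cg.
have h2 := le_trans (ler_normD (G i (pt g) - H (pt g)) (H (pt g) - H c)) (lerD (ptP g) (lexx _)).
have h3 : `|H (pt g) - H c| <= eps / 4 by rewrite distrC (le_trans (HL _ _)).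
lra.
Qed.

End ultrafilter_limit.

(** * Iterated norms *)

Lemma ler_cvg_near (R : realType) (T : Type) (F : set_system T)
    (FF : ProperFilter F) (f g : T -> R) (l m : R) :
  f i @[i --> F] --> l -> g i @[i --> F] --> m ->
  (\forall i \near F, f i <= g i) -> l <= m.
Proof.
move=> fl gm fg; have FF' : Filter F by exact: _.
have h := cvgB (FF := FF') gm fl.
rewrite -subr_ge0 -(cvg_lim (@norm_hausdorff _ _) h).
apply: limr_ge; first exact: cvgP h.
by apply: filterS fg => i; rewrite subr_ge0.
Qed.

Section iterated_norm.
Context (R : realType) (E : normedModType R) (T : Type) (U : set_system T)
  {UF : UltraFilter U} (w : T -> E).
Implicit Types (a b c : nat -> R) (x y : E).

Let FU : Filter U. Proof. exact: _. Qed.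

(* The norm of [x + a_0 v_0 + ... + a_(n-1) v_(n-1)] where the successive v's
   are copies of [w] taken infinitely far along [U]. *)
Fixpoint iter_norm (n : nat) a x : R :=
  if n is n'.+1 then lim (iter_norm n' (a \o succn) (x + a 0%N *: w i) @[i --> U])
  else `|x|.

Hypothesis w1 : \forall i \near U, `|w i| = 1.

(** Each added vector has norm 1 along [U]. The resulting bound is what makes the limits in
    [iter_norm] exist. *)
Lemma iter_norm_bound n a x : `|iter_norm n a x| <= `|x| + \sum_(i < n) `|a i|.
Proof.
elim: n a x => [|n IH] a x; first by rewrite big_ord0 addr0 /= normr_id.
have bd : \forall i \near U, `|iter_norm n (a \o succn) (x + a 0%N *: w i)| <=
    `|x| + \sum_(i < n.+1) `|a i|.
  apply: filterS w1 => i wi; apply: (le_trans (IH _ _)).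
  rewrite big_ord_recl /= addrA lerD2r (le_trans (ler_normD _ _))//.
  by rewrite normrZ wi mulr1.
rewrite ler_norml; apply/andP; split.
  apply: limr_ge; first exact: ultra_bounded_cvg bd.
  by apply: filterS bd => i; rewrite ler_norml => /andP[].
apply: limr_le; first exact: ultra_bounded_cvg bd.
by apply: filterS bd => i; rewrite ler_norml => /andP[].
Qed.

Lemma iter_normS n a x :
  iter_norm n (a \o succn) (x + a 0%N *: w i) @[i --> U] --> iter_norm n.+1 a x.
Proof.
apply: (@ultra_bounded_cvg _ _ _ _ _ (`|x| + `|a 0%N| + \sum_(i < n) `|a i.+1|)).
apply: filterS w1 => i wi; apply: (le_trans (iter_norm_bound _ _ _)).
rewrite lerD2r (le_trans (ler_normD _ _))//.
by rewrite normrZ wi mulr1.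
Qed.

Lemma iter_norm_lim n a x (l : R) :
  iter_norm n (a \o succn) (x + a 0%N *: w i) @[i --> U] --> l ->
  iter_norm n.+1 a x = l.
Proof. exact: (cvg_lim (@norm_hausdorff _ _)). Qed.

Lemma iter_normD n a b x y :
  iter_norm n (a + b) (x + y) <= iter_norm n a x + iter_norm n b y.
Proof.
elim: n a b x y => [|n IH] a b x y; first exact: ler_normD.
have h := cvgD (FF := FU) (@iter_normS n a x) (@iter_normS n b y).
apply: ler_cvg_near (@iter_normS n _ _) h _.
apply: nearW => i; rewrite !fctE scalerDl addrACA.
exact: IH.
Qed.

Lemma iter_normZ n (k : R) a x :
  iter_norm n (k *: a) (k *: x) = `|k| * iter_norm n a x.
Proof.
elim: n a x => [|n IH] a x; first exact: normrZ.
apply: iter_norm_lim.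
have := cvgMl_tmp (FF := FU) (a := `|k|) (@iter_normS n a x).
have -> : (fun i => `|k| * iter_norm n (a \o succn) (x + a 0%N *: w i)) = 
  fun i => iter_norm n ((k *: a) \o succn) (k *: x + (k *: a) 0%N *: w i).
  by apply/funext => i; rewrite -IH scalerDr scalerA.
exact.
Qed.

Lemma iter_norm_lipschitz n a b x y :
  `|iter_norm n a x - iter_norm n b y| <= `|x - y| + \sum_(i < n) `|a i - b i|.
Proof.
have h a' b' x' y' : iter_norm n a' x' - iter_norm n b' y' <=
    `|x' - y'| + \sum_(i < n) `|a' i - b' i|.
  rewrite lerBlDr -{1}(subrK b' a') -{1}(subrK y' x').
  apply: (le_trans (iter_normD _ _ _ _ _)); rewrite lerD2r.
  exact: le_trans (ler_norm _) (iter_norm_bound _ _ _).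
rewrite ler_norml h andbT lerNl opprB (le_trans (h _ _ _ _))// distrC lerD2l.
by apply: ler_sum => i _; rewrite distrC.
Qed.

Lemma iter_norm0 n a x : (forall i, a i = 0) -> iter_norm n a x = `|x|.
Proof.
elim: n a => [//|n IH] a a0; apply: iter_norm_lim.
rewrite (_ : (fun i => _) = cst `|x|); first exact: cvg_cst.
by apply/funext => i; rewrite a0 scale0r addr0; apply: IH => j; apply: a0.
Qed.

Lemma iter_norm_trunc n m a x : (n <= m)%N -> (forall i, (n <= i)%N -> a i = 0) ->
  iter_norm m a x = iter_norm n a x.
Proof.
elim: n m a x => [|n IH] m a x; first by move=> _ a0; apply: iter_norm0 => i; apply: a0.
case: m => [//|m] nm a0; apply: iter_norm_lim.
rewrite (_ : (fun i => _) = fun i => iter_norm n (a \o succn) (x + a 0%N *: w i)).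
  exact: iter_normS.
by apply/funext => i; apply: IH => // j nj; apply: a0.
Qed.

Lemma iter_norm_unit n : iter_norm n.+1 (fun i => (i == n)%:R) 0 = 1.
Proof.
have c1 : (1 : R) @[_ --> U] --> (1 : R) by exact: cvg_cst.
elim: n => [|n IH]; apply: iter_norm_lim.
  apply: cvg_trans c1.
  by apply: near_eq_cvg; apply: filterS w1 => i; rewrite /= add0r scale1r => ->.
apply: cvg_trans c1.
by apply: near_eq_cvg; apply: nearW => i; rewrite scale0r addr0 -[LHS]IH.
Qed.

Hypothesis lsc : forall x (k eta : R), 0 < eta ->
  \forall i \near U, `|x| - eta <= `|x + k *: w i|.

(** The transversality [lsc] settles [n = 0] in the limit, and the induction passes the inequality
    through the outer limit. The limit basis is thereby monotone. *)
Lemma iter_norm_mono n a x : iter_norm n a x <= iter_norm n.+1 a x.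
Proof.
elim: n a x => [|n IH] a x.
  apply/ler_addgt0Pr => e e0; rewrite -lerBlDr.
  apply: limr_ge; first exact: cvgP (@iter_normS 0%N _ _).
  exact: lsc.
apply: ler_cvg_near (@iter_normS _ _ _) (@iter_normS _ _ _) _.
by apply: nearW => i; exact: IH.
Qed.

End iterated_norm.

(** * A criterion for basic sequences *)

Section basis_criterion.
Context (R : realType) (E : normedModType R) (e : nat -> E) (K : R).
Implicit Types a b : nat -> R.

Let S a n := \sum_(i < n) a i *: e i.

Let SB a b n : S (a - b) n = S a n - S b n.
Proof.
by rewrite /S -sumrB; apply: eq_bigr => i _; rewrite !fctE scalerBl.
Qed.

Hypothesis e1 : normalized_seq e.
Hypothesis eK : forall a m n, (m <= n)%N -> `|S a m| <= K * `|S a n|.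

Let K0 : 0 <= K.
Proof.
have := eK (fun=> 1) (leqnn 1); rewrite /S big_ord_recl big_ord0 addr0 scale1r e1 mulr1.
exact: le_trans.
Qed.

Lemma coef_le_basis a m n : (m < n)%N -> `|a m| <= 2 * K * `|S a n|.
Proof.
move=> mn; have <- : `|a m *: e m| = `|a m| by rewrite normrZ e1 mulr1.
rewrite (_ : a m *: e m = S a m.+1 - S a m); last first.
  by rewrite /S big_ord_recr /= [RHS]addrAC subrr add0r.
apply: (le_trans (ler_normB _ _)); rewrite -mulrA mulr_natl mulr2n.
by rewrite lerD// eK// ltnW.
Qed.

(** Grunblum's criterion. As [E] is not assumed complete, the expansion of [x] is found
    coefficientwise: the coefficients of finitely supported approximants are Cauchy in [R], because
    the partial-sum projections are bounded by [K]. *)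
Lemma basic_sequence_of_le : basic_sequence e.
Proof.
split=> [i|x clx].
  apply: subset_closure; exists i.+1, (fun j => (j == i)%:R).
  rewrite big_ord_recr /= eqxx scale1r big1 ?add0r// => j _.
  by rewrite ltn_eqF ?scale0r.
have cvg_coef a b : S a @ \oo --> x -> S b @ \oo --> x -> a = b.
  move=> Sa Sb; apply/funext => m; apply/eqP; rewrite -subr_eq0 -normr_eq0.
  rewrite eq_le normr_ge0 andbT; apply/ler_addgt0Pr => eps eps0; rewrite add0r.
  have SB0 : S (a - b) n @[n --> \oo] --> (0 : E).
    by under eq_fun do rewrite SB; rewrite -(subrr x); exact: cvgB.
  have d0 : 0 < eps / (2 * K + 1) by rewrite divr_gt0// ltr_wpDl// mulr_ge0.
  have /cvgr0Pnorm_le/(_ _ d0)[N _ SN] := SB0.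
  have /= h := SN (N + m.+1)%N (leq_addr _ _).
  apply: (le_trans (@coef_le_basis (a - b) m (N + m.+1) (leq_addl _ _))).
  apply: (@le_trans _ _ (2 * K * (eps / (2 * K + 1)))).
    by rewrite ler_wpM2l// mulr_ge0.
  rewrite mulrCA ler_piMr// ?(ltW eps0)// ler_pdivrMr ?ltr_wpDl ?mulr_ge0//.
  by rewrite mul1r lerDl.
suff [a Sa] : exists a, S a @ \oo --> x.
  by exists a; split=> // b /(cvg_coef _ _ Sa).
have /choice[y yP] : forall k : nat, exists y : nat * (nat -> R),
    `|x - S y.2 y.1| <= k.+1%:R^-1 /\ forall i, (y.1 <= i)%N -> y.2 i = 0.
  move=> k; have k0 : (0 : R) < k.+1%:R^-1 by rewrite invr_gt0 ltr0n.
  have [z [[n [a ->]] xz]] := clx _ (nbhsx_ballx x _ k0).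
  exists (n, fun i => if (i < n)%N then a i else 0); split=> /=.
    suff -> : S (fun i => if (i < n)%N then a i else 0) n = \sum_(i < n) a i *: e i.
      by move: xz; rewrite -ball_normE => /ltW.
    by apply: eq_bigr => i _; rewrite ltn_ord.
  by move=> i; rewrite leqNgt => /negbTE ->.
pose N k := (y k).1; pose A k := (y k).2.
have A0 k i : (N k <= i)%N -> A k i = 0 by exact: (yP k).2.
have xA k : `|x - S (A k) (N k)| <= k.+1%:R^-1 by exact: (yP k).1.
have AN k m : (N k <= m)%N -> S (A k) m = S (A k) (N k).
  move=> /subnKC <-; rewrite /S big_split_ord /= [X in _ + X]big1 ?addr0// => i _.
  by rewrite A0 ?scale0r// leq_addr.
have AA k l m : `|S (A k) m - S (A l) m| <= K * (k.+1%:R^-1 + l.+1%:R^-1).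
  rewrite -SB; apply: (le_trans (@eK _ m (maxn m (maxn (N k) (N l))) (leq_maxl _ _))).
  rewrite ler_wpM2l// SB !AN; last 2 first.
  - by rewrite !leq_max leqnn !orbT.
  - by rewrite !leq_max leqnn !orbT.
  rewrite -(subrK x (S _ _)) -addrA (le_trans (ler_normD _ _))//.
  by rewrite lerD// distrC.
have Acoef k l m : `|A k m - A l m| <= 2 * K * (k.+1%:R^-1 + l.+1%:R^-1).
  have <- : `|(A k m - A l m) *: e m| = `|A k m - A l m| by rewrite normrZ e1 mulr1.
  rewrite (_ : _ *: e m = (S (A k) m.+1 - S (A l) m.+1) - (S (A k) m - S (A l) m)); last first.
    by rewrite -!SB [S _ m.+1]big_ord_recr /= -/(S _ _) [RHS]addrAC subrr add0r.
  by rewrite (le_trans (ler_normB _ _))// -mulrA mulr_natl mulr2n lerD.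
have inv0 (C : R) : C * (k.+1%:R^-1) @[k --> \oo] --> (0 : R).
  rewrite -(mulr0 C); apply: cvgMl_tmp; exact: cvg_harmonic.
have /choice[a Aa] : forall m, exists a : R, A k m @[k --> \oo] --> a.
  move=> m; apply/cvg_ex/cauchy_cvgP/cauchy_exP => eps eps0.
  have /cvgr0Pnorm_lt/(_ (eps / 2)) := inv0 (2 * K).
  rewrite divr_gt0// => /(_ isT)[k0 _ k0P]; exists (A k0 m).
  exists k0 => // k /= kk0; rewrite /ball /=.
  apply: (le_lt_trans (Acoef _ _ _)); rewrite mulrDr [ltRHS]splitr.
  by rewrite ltrD// (le_lt_trans (ler_norm _))// k0P//=.
(* Letting [l] tend to infinity in [AA] with [m] fixed gives an estimate uniform in [m]. *)
have Sa k m : `|S (A k) m - S a m| <= K * k.+1%:R^-1.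
  have h1 : `|S (A k) m - S (A l) m| @[l --> \oo] --> `|S (A k) m - S a m|.
    apply: cvg_norm; apply: cvgB; first exact: cvg_cst.
    apply: (@cvg_big _ _ _ 0); first exact: add_continuous.
    by move=> i _; apply: cvgZr_tmp; exact: Aa.
  have h2 : K * k.+1%:R^-1 + K * l.+1%:R^-1 @[l --> \oo] --> K * k.+1%:R^-1.
    by rewrite -[X in _ --> X]addr0; apply: cvgD (inv0 K); exact: cvg_cst.
  by apply: ler_cvg_near h1 h2 _; apply: nearW => l; rewrite -mulrDr.
exists a; apply/cvgrPdist_le => eps eps0.
have /cvgr0Pnorm_le/(_ _ eps0)[k _ /(_ k (leqnn k)) kP] := inv0 (1 + K).
exists (N k) => // m /= km.
rewrite -(subrK (S (A k) m) x) -addrA (le_trans (ler_normD _ _))//.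
rewrite (le_trans _ (le_trans (ler_norm _) kP))// mulrDl mul1r lerD//.
by rewrite AN.
Qed.

End basis_criterion.

(** * Completion of a monotone norm *)

(* [mnorm N n a] is the norm of [a_0 v_0 + ... + a_(n-1) v_(n-1)] for a monotone
   normalized basic sequence [v]. *)
Record monotone_norm (R : realType) := MonotoneNorm {
  mnorm :> nat -> (nat -> R) -> R;
  mnorm_le_sum : forall n a, mnorm n a <= \sum_(i < n) `|a i|;
  mnormD : forall n a b, mnorm n (a + b) <= mnorm n a + mnorm n b;
  mnormZ : forall n (k : R) a, mnorm n (k *: a) = `|k| * mnorm n a;
  mnormS : forall n a, mnorm n a <= mnorm n.+1 a;
  mnorm_pad : forall n m a, (n <= m)%N -> (forall i, (n <= i)%N -> a i = 0) ->
    mnorm m a = mnorm n a;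
  mnorm_unit : forall n, mnorm n.+1 (fun i => (i == n)%:R) = 1
}.

Section monotone_norm_theory.
Context (R : realType) (N : monotone_norm R).
Implicit Types (a b c : nat -> R).

Definition trunc_seq n a i : R := if (i < n)%N then a i else 0.

Lemma trunc_seqD n a b : trunc_seq n (a + b) = trunc_seq n a + trunc_seq n b.
Proof. by apply/funext => i; rewrite !fctE /trunc_seq; case: ifP; rewrite ?addr0. Qed.

Lemma trunc_seqZ n (k : R) a : trunc_seq n (k *: a) = k *: trunc_seq n a.
Proof. by apply/funext => i; rewrite !fctE /trunc_seq; case: ifP; rewrite ?scaler0. Qed.

Lemma mnorm0 n : N n 0 = 0.
Proof. by rewrite -(scale0r (0 : nat -> R)) mnormZ normr0 mul0r. Qed.

Lemma mnormN n a : N n (- a) = N n a.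
Proof. by rewrite -scaleN1r mnormZ normrN1 mul1r. Qed.

Lemma mnormB n a b : N n (a - b) <= N n a + N n b.
Proof. by rewrite -(mnormN n b) mnormD. Qed.

Lemma ler_mnorm n m a : (n <= m)%N -> N n a <= N m a.
Proof.
by move=> /subnK <-; elim: (m - n)%N => // k; move/le_trans; apply; exact: mnormS.
Qed.

Lemma mnorm_local n a b : (forall i, (i < n)%N -> a i = b i) -> N n a = N n b.
Proof.
have le a' b' : (forall i, (i < n)%N -> a' i = b' i) -> N n a' <= N n b'.
  move=> ab; rewrite -{1}(subrK b' a') (le_trans (mnormD _ _ _ _))// gerDr.
  apply: (le_trans (mnorm_le_sum _ _ _)); rewrite big1// => i _.
  by rewrite !fctE ab ?subrr ?normr0.
by move=> ab; apply/eqP; rewrite eq_le !le// => i /ab.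
Qed.

Lemma mnorm_trunc n m a : N m (trunc_seq n a) = N (minn n m) a.
Proof.
have [mn|nm] := leqP m n.
  by apply: mnorm_local => i im; rewrite /trunc_seq (leq_trans im mn).
rewrite (@mnorm_pad _ N n) ?(ltnW nm)//; last first.
  by move=> i ni; rewrite /trunc_seq ltnNge ni.
by apply: mnorm_local => i im; rewrite /trunc_seq im.
Qed.

(** The term of index [m] is the difference of two truncations, neither of norm larger than that of
    [a]. *)
Lemma mnorm_coef n m a : (m < n)%N -> `|a m| <= 2 * N n a.
Proof.
move=> mn; have -> : `|a m| = N m.+1 (trunc_seq m.+1 a - trunc_seq m a).
  have -> : trunc_seq m.+1 a - trunc_seq m a = a m *: (fun i => (i == m)%:R).
    apply/funext => i; rewrite !fctE /trunc_seq ltnS.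
    case: (ltngtP i m) => [||->]; rewrite ?subrr ?scaler0 ?subr0//.
    by rewrite [RHS]mulr1.
  by rewrite mnormZ mnorm_unit mulr1.
rewrite (le_trans (mnormB _ _ _))// !mnorm_trunc minnn mulr_natl mulr2n.
by rewrite lerD// ler_mnorm// (leq_trans (geq_minl _ _))// ltnW.
Qed.

(** The Cauchy criterion for the series with coefficients [a]. The completion is realised as the
    space of these coefficient sequences rather than as a quotient of Cauchy sequences. *)
Definition small_tails a :=
  forall eps : R, 0 < eps -> exists n, forall m, N m (a - trunc_seq n a) <= eps.

(** The tail beyond [n'] is the tail beyond [n] minus a truncation of it, whence the factor 2. This
    lets two thresholds be replaced by their maximum. *)
Lemma mnorm_tail_le n n' m a (eps : R) : (n <= n')%N ->
  (forall m, N m (a - trunc_seq n a) <= eps) ->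
  N m (a - trunc_seq n' a) <= 2 * eps.
Proof.
move=> nn' tail; have -> : a - trunc_seq n' a =
    (a - trunc_seq n a) - trunc_seq n' (a - trunc_seq n a).
  apply/funext => i; rewrite !fctE /trunc_seq.
  case: (ltnP i n) => [/leq_trans/(_ nn') ->|ni]; first by rewrite subrr subr0.
  by case: ifP => _; rewrite !subr0// subrr.
rewrite (le_trans (mnormB _ _ _))// mulr_natl mulr2n lerD//.
by rewrite mnorm_trunc.
Qed.

Lemma small_tails_submod : submod_closed [pred a | `[< small_tails a >]].
Proof.
split=> [|k a b /asboolP sa /asboolP sb]; apply/asboolP => eps eps0.
  exists 0%N => m; rewrite (_ : _ - _ = 0) ?mnorm0 ?ltW//.
  by apply/funext => i; rewrite !fctE subrr.
have k0 : 0 < 1 + `|k| by rewrite ltr_wpDr.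
have d0 : 0 < eps / (2 * (1 + `|k|)) by rewrite divr_gt0// mulr_gt0.
have [n1 h1] := sa _ d0; have [n2 h2] := sb _ d0.
exists (maxn n1 n2) => m.
rewrite trunc_seqD trunc_seqZ opprD addrACA -scalerBr (le_trans (mnormD _ _ _ _))//.
rewrite mnormZ.
have := mnorm_tail_le m (leq_maxl n1 n2) h1.
have := mnorm_tail_le m (leq_maxr n1 n2) h2.
have -> : 2 * (eps / (2 * (1 + `|k|))) = eps / (1 + `|k|) by field; rewrite gt_eqF.
move=> t2 t1; apply: (le_trans (lerD (ler_wpM2l (normr_ge0 k) t1) t2)).
by rewrite -[X in _ + X]mul1r -mulrDl addrC mulrCA divff ?mulr1 ?gt_eqF.
Qed.

Record completion := Completion {
  coord :> nat -> R;
  _ : coord \in [pred a | `[< small_tails a >]] }.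

HB.instance Definition _ := [isSub for coord].
HB.instance Definition _ := [Choice of completion by <:].
HB.instance Definition _ := GRing.isSubmodClosed.Build R (nat -> R)
  [pred a | `[< small_tails a >]] small_tails_submod.
HB.instance Definition _ := [SubChoice_isSubLmodule of completion by <:].

Lemma small_tails_coord (u : completion) : small_tails u.
Proof. by case: u => a /= /asboolP. Qed.

Definition completion_norm (u : completion) : R := lim (N n u @[n --> \oo]).

Lemma is_cvg_mnorm (u : completion) : cvg (N n u @[n --> \oo]).
Proof.
apply: nondecreasing_is_cvgn; first by move=> n m; exact: ler_mnorm.
have [n h] := small_tails_coord u ltr01.
exists (1 + N n u) => _ [m _ <-].
rewrite -[X in N m X](subrK (trunc_seq n u)) (le_trans (mnormD _ _ _ _))//.
by rewrite lerD// mnorm_trunc ler_mnorm// geq_minl.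
Qed.

Lemma mnorm_le_completion n (u : completion) : N n u <= completion_norm u.
Proof.
apply: limr_ge; first exact: is_cvg_mnorm.
by exists n => // m /= nm; exact: ler_mnorm.
Qed.

Lemma completion_norm_le (u : completion) M :
  (forall n, N n u <= M) -> completion_norm u <= M.
Proof.
by move=> uM; apply: limr_le; [exact: is_cvg_mnorm|exact: nearW].
Qed.

Lemma completion_normD u v :
  completion_norm (u + v) <= completion_norm u + completion_norm v.
Proof.
apply: completion_norm_le => n; apply: (le_trans (mnormD _ _ _ _)).
by rewrite lerD// mnorm_le_completion.
Qed.

Lemma completion_normZ (k : R) u : completion_norm (k *: u) = `|k| * completion_norm u.
Proof.
apply: (cvg_lim (@norm_hausdorff _ _)).
have -> : (fun n => N n (k *: u)%R) = (fun n => `|k| * N n u).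
  by apply/funext => n; exact: mnormZ.
by apply: cvgMl_tmp; exact: is_cvg_mnorm.
Qed.

Lemma completion_norm0_eq0 u : completion_norm u = 0 -> u = 0.
Proof.
move=> u0; apply/val_inj/funext => i; apply/eqP; rewrite -normr_eq0.
rewrite eq_le normr_ge0 andbT (le_trans (mnorm_coef u (ltnSn i)))//.
by rewrite -[leRHS](mulr0 2) ler_wpM2l// -u0 mnorm_le_completion.
Qed.

HB.instance Definition _ := Lmodule_isNormed.Build R completion
  completion_normD completion_normZ completion_norm0_eq0.

End monotone_norm_theory.

(** * Completeness of the completed space and its unit vector basis *)

Section completion_theory.
Context (R : realType) (N : monotone_norm R).
Implicit Types (a b c : nat -> R) (u v : completion N).

Lemma mnorm_le_norm n u : N n u <= `|u|.
Proof. exact: mnorm_le_completion. Qed.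

Lemma mnorm_lipschitz n a b : N n a <= N n b + \sum_(i < n) `|a i - b i|.
Proof.
rewrite -{1}(subrK b a) (le_trans (mnormD _ _ _ _))// addrC lerD2l.
exact: mnorm_le_sum.
Qed.

(** Coordinates are 2-Lipschitz, so a Cauchy filter converges coordinatewise to some [b]. Since
    [N m] sees only [m] coordinates, the Cauchy bounds pass to [b]. *)
Lemma completion_complete (F : set_system (completion N)) :
  ProperFilter F -> cauchy F -> cvg F.
Proof.
move=> FF /cauchyP Fc.
have Fball eps : 0 < eps -> exists u, F [set v | `|u - v| < eps].
  by move=> /Fc [u]; rewrite -ball_normE; exists u.
have /choice[b bP] : forall i, exists b : R, coord u i @[u --> F] --> b.
  move=> i; apply/cvg_ex/cauchy_cvgP/cauchy_exP => eps eps0.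
  have [|u Fu] := Fball (eps / 2); first by rewrite divr_gt0.
  exists (u i); suff : F [set v : completion N | `|u i - v i| < eps] by [].
  apply: filterS Fu => v /= uv.
  have := @mnorm_coef _ N _ _ (u - v) (ltnSn i) => /le_lt_trans; apply.
  rewrite (le_lt_trans (ler_wpM2l _ (mnorm_le_norm _ _)))//.
  by rewrite mulrC -ltr_pdivlMr.
have near_b n eta : 0 < eta ->
    F [set u : completion N | \sum_(i < n) `|u i - b i| <= eta].
  move=> eta0; have h : \sum_(i < n) `|coord u i - b i| @[u --> F] --> \sum_(i < n) `|b i - b i|.
    apply: (@cvg_big _ _ _ 0); first exact: add_continuous.
    by move=> i _; apply: cvg_norm; apply: cvgB; [exact: bP|exact: cvg_cst].
  have /cvgrPdist_le/(_ _ eta0) := h; apply: filterS => u.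
  rewrite big1 => [|i _]; last by rewrite subrr normr0.
  by rewrite sub0r normrN; apply: le_trans; exact: ler_norm.
have dist_b eps u m : F [set v | `|u - v| < eps] -> N m ((u : nat -> R) - b) <= eps.
  move=> Fu; apply/ler_addgt0Pr => eta eta0.
  have [v [/= uv vb]] := filter_ex (filterI Fu (near_b m _ eta0)).
  rewrite (le_trans (mnorm_lipschitz m _ ((u : nat -> R) - v)))// lerD//.
    exact: le_trans (mnorm_le_norm m (u - v)) (ltW uv).
  apply: le_trans vb; apply: ler_sum => i _; rewrite !fctE.
  by have -> : coord u i - b i - (coord u i - coord v i) = coord v i - b i by ring.
(* The tail of [b] is that of a nearby [u] minus that of [u - b]; the latter splits into [u - b] and
   its truncation, which gives three thirds. *)
have sb : small_tails N b.
  move=> eps eps0; have [|u Fu] := Fball (eps / 3); first by rewrite divr_gt0.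
  have [|n tn] := small_tails_coord u (_ : 0 < eps / 3); first by rewrite divr_gt0.
  exists n => m.
  rewrite (_ : b - trunc_seq n b = ((u : nat -> R) - trunc_seq n u) -
     (((u : nat -> R) - b) - trunc_seq n ((u : nat -> R) - b))); last first.
    by apply/funext => i; rewrite !fctE /trunc_seq; case: ifP => _; ring.
  rewrite (le_trans (mnormB _ _ _ _))// (_ : eps = eps / 3 + (eps / 3 + eps / 3)); last by field.
  by rewrite lerD// (le_trans (mnormB _ _ _ _))// lerD ?mnorm_trunc ?dist_b.
have bin : b \in [pred a | `[< small_tails N a >]] by apply/asboolP.
pose B := Completion bin; apply/cvg_ex; exists B; apply/cvgrPdist_le => eps eps0.
have [|u Fu] := Fball (eps / 2); first by rewrite divr_gt0.
apply: filterS (Fu) => v /= uv; rewrite -(subrK u B) -addrA (le_trans (ler_normD _ _))//.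
rewrite [leRHS]splitr lerD// ?(ltW uv)// distrC.
by apply: completion_norm_le => m; exact: dist_b Fu.
Qed.

HB.instance Definition _ := isPointed.Build (completion N) 0.
HB.instance Definition _ := Uniform_isComplete.Build (completion N)
  completion_complete.
Definition completion_module : completeNormedModType R := completion N.

Lemma finitely_supported_small_tails n a : small_tails N (trunc_seq n a).
Proof.
move=> eps eps0; exists n => m.
rewrite (_ : _ - _ = 0) ?mnorm0 ?ltW//; apply/funext => i.
by rewrite !fctE /trunc_seq; case: ifP; rewrite subrr.
Qed.

Definition completion_trunc n a : completion N :=
  Completion (introT (asboolP _) (@finitely_supported_small_tails n a)).

Lemma norm_completion_trunc n a : `|completion_trunc n a| = N n a.
Proof.
apply/eqP; rewrite eq_le; apply/andP; split.
  by apply: completion_norm_le => m; rewrite /= mnorm_trunc ler_mnorm ?geq_minl.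
by rewrite (le_trans _ (mnorm_le_norm n _))//= mnorm_trunc minnn.
Qed.

Definition completion_unit n : completion_module :=
  completion_trunc n.+1 (fun i => (i == n)%:R).

Lemma sum_completion_unit n a :
  \sum_(i < n) a i *: completion_unit i = completion_trunc n a.
Proof.
elim: n => [|n IH].
  by rewrite big_ord0; apply/val_inj/funext => i.
rewrite big_ord_recr IH; apply/val_inj/funext => i.
rewrite /= !fctE /trunc_seq /= ltnS.
by case: (ltngtP i n) => [||->]; rewrite ?addr0 ?scaler0 ?add0r ?addr0//; exact: mulr1.
Qed.

Lemma completion_unit_normalized : normalized_seq completion_unit.
Proof. by move=> n; rewrite norm_completion_trunc mnorm_unit. Qed.

(** Monotonicity gives the criterion with constant 1, and small tails mean that finitely supported
    vectors are dense. *)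
Lemma completion_unit_basis : schauder_basis setT completion_unit.
Proof.
have [h1 h2] : basic_sequence completion_unit.
  apply: (@basic_sequence_of_le _ _ _ 1); first exact: completion_unit_normalized.
  move=> a m n mn; rewrite mul1r !sum_completion_unit !norm_completion_trunc.
  exact: ler_mnorm.
suff cl : closure (linear_span completion_unit) = setT by rewrite -cl.
rewrite -subTset => u _ B /nbhs_ballP[eps /= eps0 epsB].
have [|n tn] := small_tails_coord u (_ : 0 < eps / 2); first by rewrite divr_gt0.
exists (completion_trunc n u); split.
  by exists n, u; rewrite sum_completion_unit.
apply: epsB; rewrite -ball_normE /=.
apply: (@le_lt_trans _ _ (eps / 2)); last by rewrite gtr_pMr// invf_lt1// ltr1n.
exact: completion_norm_le.
Qed.

End completion_theory.

(** * Extraction of spreading models *)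

(** Recursive selection against the full list of earlier choices; it serves to take each vector far
    along [U] relative to all preceding ones. *)
Lemma sequence_choice (T : Type) (P : seq T -> T -> Prop) :
  (forall l, exists i, P l i) -> exists s : nat -> T, forall n, P (mkseq s n) (s n).
Proof.
move=> /choice[f fP].
pose fix hist n := if n is n'.+1 then rcons (hist n') (f (hist n')) else [::].
exists (fun n => f (hist n)) => n; suff -> : mkseq (fun n => f (hist n)) n = hist n by [].
by elim: n => // n IH; rewrite mkseqS IH.
Qed.

Section spreading_subsequence.
Context (R : realType) (E : normedModType R) (T : Type) (U : set_system T)
  {UF : UltraFilter U} (w : T -> E).
Hypothesis w1 : \forall i \near U, `|w i| = 1.
Hypothesis w_le1 : forall i, `|w i| <= 1.
Hypothesis lsc : forall x (k eta : R), 0 < eta ->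
  \forall i \near U, `|x| - eta <= `|x + k *: w i|.

Local Notation F := (iter_norm U w).

(** The limit norm of the Brunel-Sucheston construction. It is closed by [Defined] because it must
    unfold to [iter_norm] when the spreading model is checked. *)
Definition iter_monotone_norm : monotone_norm R.
Proof.
apply: (@MonotoneNorm R (fun n a => F n a 0)).
- move=> n a; apply: (le_trans (ler_norm _)).
  by have := iter_norm_bound (UF := UF) w1 n a 0; rewrite normr0 add0r.
- by move=> n a b; have := iter_normD (UF := UF) w1 n a b 0 0; rewrite addr0.
- by move=> n k a; rewrite -(iter_normZ (UF := UF) w1) scaler0.
- by move=> n a; exact: iter_norm_mono.
- by move=> n m a; exact: iter_norm_trunc.
- by move=> n; exact: iter_norm_unit.
Defined.

(** A uniform form of [iter_normS]: all coefficients, those of the earlier vectors in [l] and those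
    of the remaining limits, form one point of a cube, so [uniform_near_cube] applies for each of
    the finitely many [r]. *)
Lemma near_iter_norm (l : seq T) (n : nat) (eps : R) : 0 < eps ->
  \forall i \near U, forall r, (r <= n)%N -> forall (c b : nat -> R) (x : E),
    (forall j, `|c j| <= 1) -> (forall j, `|b j| <= 1) ->
    x = \sum_(j < size l) c j *: nth 0 (map w l) j ->
    `|F r (b \o succn) (x + b 0%N *: w i) - F r.+1 b x| <= eps.
Proof.
move=> eps0; pose m := size l.
pose X (c : nat -> R) := \sum_(j < m) c j *: nth 0 (map w l) j.
have XL c c' : `|X c - X c'| <= \sum_(j < m) `|c j - c' j|.
  rewrite /X -sumrB (le_trans (ler_norm_sum _ _ _))//; apply: ler_sum => j _.
  rewrite -scalerBl normrZ ler_piMr//; move: (nat_of_ord j).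
  by elim: (l) => [|t k IH] [|i] //=; rewrite normr0.
suff near_r (r : 'I_n.+1) : \forall i \near U, forall c : nat -> R, (forall j, `|c j| <= 1) ->
    `|F r (fun j => c (m + j.+1)%N) (X c + c m *: w i) - F r.+1 (fun j => c (m + j)%N) (X c)| <= eps.
  have : \forall i \near U, forall r : 'I_n.+1, forall c : nat -> R, (forall j, `|c j| <= 1) ->
    `|F r (fun j => c (m + j.+1)%N) (X c + c m *: w i) - F r.+1 (fun j => c (m + j)%N) (X c)| <= eps.
    exact: filter_forall.
  move=> H; apply: filterS H => i h r rn c b x c1 b1 xE.
  (* [d] concatenates the coefficients of the earlier vectors and those of the limits. *)
  pose d j := if (j < m)%N then c j else b (j - m)%N.
  have d1 j : `|d j| <= 1 by rewrite /d; case: ifP.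
  have := h (Ordinal (rn : (r < n.+1)%N)) d d1.
  have -> : X d = x by rewrite xE; apply: eq_bigr => j _; rewrite /d ltn_ord.
  have dm j : d (m + j)%N = b j by rewrite /d ltnNge leq_addr addKn.
  rewrite (_ : (fun j => d (m + j.+1)%N) = b \o succn); last first.
    by apply/funext => j; rewrite dm.
  rewrite (_ : (fun j => d (m + j)%N) = b); last by apply/funext => j; rewrite dm.
  by rewrite -[m in d m]addn0 dm.
apply: (@uniform_near_cube _ _ _ _ (m + r.+1)) => //.
- move=> c; have := iter_normS (UF := UF) w1 (n := r) (a := fun j => c (m + j)%N) (x := X c).
  by rewrite /= addn0.
- apply: filterS w1 => i wi c c'; apply: (le_trans (iter_norm_lipschitz (UF := UF) w1 _ _ _ _ _)).
  rewrite big_split_ord [Y in _ <= _ + Y]big_ord_recl /= addrA addn0 lerD//.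
  rewrite opprD addrACA -scalerBl (le_trans (ler_normD _ _))// lerD//.
  by rewrite normrZ wi mulr1.
- move=> c c'; apply: (le_trans (iter_norm_lipschitz (UF := UF) w1 _ _ _ _ _)).
  by rewrite big_split_ord /= lerD.
Qed.

(** The geometric factor makes the errors summable for the basic-sequence estimate; the factor
    [1 / (n + 1)] absorbs the number of replacements in the spreading-model estimate. *)
Let eps (n : nat) : R := 2^-1 ^+ (n + 4) / n.+1%:R.

Let eps_gt0 n : 0 < eps n.
Proof. by rewrite divr_gt0// exprn_gt0. Qed.

Let eps_le n : eps n <= 2^-1 ^+ (n + 4).
Proof. by rewrite ler_pdivrMr// ler_peMr ?exprn_ge0// ler1n. Qed.

Let eps_anti m n : (m <= n)%N -> eps n <= eps m.
Proof.
move=> mn; rewrite ler_pM ?invr_ge0 ?exprn_ge0//.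
  by rewrite ler_wiXn2l ?invr_ge0 ?invf_le1 ?ler1n// leq_add2r.
by rewrite lef_pV2 ?posrE ?ltr0n// ler_nat ltnS.
Qed.

Context (P : nat -> T -> Prop) (nearP : forall n, \forall i \near U, P n i).

(** Each [s n] is taken so far along [U] that replacing one limit by the vector [w (s n)] costs at
    most [eps n], uniformly over the earlier vectors. Accumulating these errors gives both the basis
    constant and the spreading model. [P] carries further demands on the [n]-th choice. *)
Lemma spreading_subsequence : exists s : nat -> T,
  [/\ forall n, P n (s n), normalized_seq (w \o s), basic_sequence (w \o s) &
      generates_spreading_model (w \o s) (completion_unit iter_monotone_norm)].
Proof.
have [s sP] : exists s : nat -> T, forall n, let l := mkseq s n in
    [/\ P n (s n), `|w (s n)| = 1 &
     forall r, (r <= n)%N -> forall (c b : nat -> R) (x : E),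
    (forall j, `|c j| <= 1) -> (forall j, `|b j| <= 1) ->
    x = \sum_(j < n) c j *: nth 0 (map w l) j ->
    `|F r (b \o succn) (x + b 0%N *: w (s n)) - F r.+1 b x| <= eps n].
  have /sequence_choice[s sP] : forall l : seq T, exists i,
    [/\ P (size l) i, `|w i| = 1 &
     forall r, (r <= size l)%N -> forall (c b : nat -> R) (x : E),
    (forall j, `|c j| <= 1) -> (forall j, `|b j| <= 1) ->
    x = \sum_(j < size l) c j *: nth 0 (map w l) j ->
    `|F r (b \o succn) (x + b 0%N *: w i) - F r.+1 b x| <= eps (size l)].
    move=> l; have h := near_iter_norm l (size l) (eps_gt0 (size l)).
    by have [i [Pi [wi hi]]] := filter_ex (filterI (nearP (size l)) (filterI w1 h)); exists i.
  by exists s => n; have := sP n; rewrite size_mkseq.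
pose e := w \o s; pose box n x := exists2 c : nat -> R, (forall j, `|c j| <= 1) &
  x = \sum_(j < n) c j *: e j.
have sel n r x (b : nat -> R) : (r <= n)%N -> box n x -> (forall j, `|b j| <= 1) ->
    `|F r (b \o succn) (x + b 0%N *: e n) - F r.+1 b x| <= eps n.
  move=> rn [c c1 xE] b1; have [_ _ /(_ r rn c b x c1 b1)] := sP n; apply.
  rewrite xE; apply: eq_bigr => j _.
  by rewrite (nth_map (s 0%N)) ?size_mkseq// nth_mkseq.
have e1 : normalized_seq e by move=> n; have [] := sP n.
have boxS n x a : box n x -> `|a| <= 1 -> box n.+1 (x + a *: e n).
  move=> [c c1 ->] a1; exists (fun j => if j == n then a else c j).
    by move=> j; case: ifP.
  rewrite big_ord_recr /= eqxx; congr (_ + _); apply: eq_bigr => j _.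
  by rewrite ltn_eqF.
have box_mono n m x : (n <= m)%N -> box n x -> box m x.
  move=> /subnK <-; elim: (m - n)%N => // k IH /IH h.
  by have := boxS _ _ 0 h; rewrite scale0r addr0 normr0; apply.
exists s; split => //; first by move=> n; have [] := sP n.
- pose S (a : nat -> R) n := \sum_(i < n) a i *: e i.
  (* By monotonicity of [iter_norm] and [sel] with [r = 0], appending the term of index [N] lowers
     the norm by at most [eps N]; these losses are dominated by the telescoping differences of
     [2^-1 ^+ (N + 3)]. *)
  have S1 a m n : (m <= n)%N -> (forall j, `|a j| <= 1) ->
      `|S a m| <= `|S a n| + (2^-1 ^+ (m + 3) - 2^-1 ^+ (n + 3)).
    move=> /subnK <- a1; elim: (n - m)%N => [|k]; first by rewrite add0n subrr addr0.
    move/le_trans; apply; rewrite addSn; set N := (k + m)%N.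
    have := sel N 0%N (S a N) (fun j => a (N + j)%N) (leq0n _).
    have bN : box N (S a N) by exists a.
    move=> /(_ bN (fun j => a1 _)); rewrite addn0.
    have := iter_norm_mono (UF := UF) w1 lsc 0 (fun j => a (N + j)%N) (S a N).
    have -> : F 0 ((fun j => a (N + j)%N) \o succn) (S a N + a N *: e N) = `|S a N.+1|.
      by rewrite /S big_ord_recr.
    rewrite ler_norml [F 0%N _ _]/= => h1 /andP[h2 _].
    have E4 : (N + 4 = (N + 3).+1)%N by rewrite addnS.
    have := eps_le N; rewrite E4 [(N.+1 + 3)%N]addSn !exprS.
    set z := 2^-1 ^+ (N + 3); set y := _ ^+ (m + 3).
    lra.
  (* Rescaling by [A] brings the coefficients into the unit cube; the total loss there is at most
     [2^-1 ^+ 3]. *)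
  have S2 a m n (A : R) : (m <= n)%N -> 0 < A -> (forall j, (j < n)%N -> `|a j| <= A) ->
      `|S a m| <= `|S a n| + A / 8.
    move=> mn A0 aA; pose c j := if (j < n)%N then A^-1 * a j else 0.
    have Sc k : (k <= n)%N -> S a k = A *: S c k.
      move=> kn; rewrite /S scaler_sumr; apply: eq_bigr => j _.
      by rewrite /c (leq_trans (ltn_ord j))// scalerA mulrA divff ?mul1r ?gt_eqF.
    have c1 j : `|c j| <= 1.
      rewrite /c; case: ifPn => [jn|_]; last by rewrite normr0.
      by rewrite normrM normfV (gtr0_norm A0) ler_pdivrMl// mulr1 aA.
    rewrite !Sc// !normrZ (gtr0_norm A0) -mulrDr ler_pM2l//.
    apply: (le_trans (S1 c m n mn c1)); rewrite lerD2l lerBlDr.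
    apply: (@le_trans _ _ (2^-1 ^+ 3)).
      by rewrite ler_wiXn2l ?invr_ge0 ?invf_le1 ?ler1n// leq_addl.
    by rewrite (_ : 2^-1 ^+ 3 = 8^-1) ?lerDl ?exprn_ge0//; field.
  (* With [A] the largest coefficient, [S2] applied to two consecutive partial sums gives
     [A <= 2 * |S a n| + A / 4], hence [A / 8 <= |S a n| / 3]. *)
  apply: (@basic_sequence_of_le _ _ _ (4 / 3)) => // a m n mn.
  pose A := \big[Num.max/0]_(j < n) `|a j|.
  have aA j : (j < n)%N -> `|a j| <= A.
    by move=> jn; exact: (le_bigmax _ (fun j : 'I_n => `|a j|) (Ordinal jn)).
  have A0 : 0 <= A by apply: bigmax_ge_id.
  move: A0; rewrite le_eqVlt => /predU1P[A0|A0].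
    rewrite big1 ?normr0 ?mulr_ge0//.
    move=> j _; have := aA j (leq_trans (ltn_ord j) mn).
    by rewrite -A0 normr_le0 => /eqP ->; rewrite scale0r.
  have : A <= 2 * `|S a n| + A / 4.
    apply: bigmax_le => [|j _]; first by rewrite addr_ge0 ?mulr_ge0 ?divr_ge0// ltW.
    have <- : `|a j *: e j| = `|a j| by rewrite normrZ e1 mulr1.
    rewrite (_ : a j *: e j = S a j.+1 - S a j); last first.
      by rewrite /S big_ord_recr /= [RHS]addrAC subrr add0r.
    have h1 := S2 a j.+1 n A (ltn_ord j) A0 aA.
    have h2 := S2 a j n A (ltnW (ltn_ord j)) A0 aA.
    by apply: (le_trans (ler_normB _ _)); lra.
  have := S2 a m n A mn A0 aA; rewrite -/(S a m) -/(S a n).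
  lra.
exists (fun n => 2^-1 ^+ n); split.
- by move=> n; rewrite exprn_gt0.
- by move=> m n mn; rewrite ler_wiXn2l ?invr_ge0 ?invf_le1 ?ler1n.
- by apply: cvg_expr; rewrite gtr0_norm// invf_lt1// ltr1n.
move=> n i a ni ii a1.
pose i' k := if insub k is Some j then i j else 0%N.
pose a' k := if insub k is Some j then a j else 0.
have iE (j : 'I_n) : i' j = i j by rewrite /i' valK.
have aE (j : 'I_n) : a' j = a j by rewrite /a' valK.
have a'1 k : `|a' k| <= 1 by rewrite /a'; case: insubP => [j _ _|_]; rewrite ?normr0.
pose x k := \sum_(j < k) a' j *: e (i' j).
have boxx k m : (k <= n)%N -> (forall j, (j < k)%N -> (i' j < m)%N) -> box m (x k).
  elim: k m => [|k IH] m kn im.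
    rewrite /x big_ord0; exists (fun=> 0) => [j|]; first by rewrite normr0.
    by rewrite big1// => j _; rewrite scale0r.
  rewrite /x big_ord_recr /=; apply: (@box_mono (i' k).+1); first exact: im.
  apply: boxS => //; apply: IH => [|j jk]; first exact: ltnW.
  by rewrite (iE (Ordinal (ltn_trans jk kn))) (iE (Ordinal kn)); exact: ii.
(* Limits are replaced by vectors one at a time: after [k] replacements, [n - k] limits remain,
   started at [x k]. *)
have main k : (k <= n)%N ->
    `|F (n - k) (fun j => a' (k + j)%N) (x k) - F n a' 0| <= k%:R * eps n.-1.
  elim: k => [|k IH] kn.
    by rewrite subn0 /x big_ord0 subrr normr0 mul0r.
  (* Indices count from 0, so admissibility reads [n <= i' k + 1]; hence the error [eps n.-1]. *)
  have ik : (n.-1 <= i' k)%N.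
    by rewrite (iE (Ordinal kn)) -ltnS prednK ?ni// (leq_ltn_trans _ kn).
  have rn : (n - k.+1 <= i' k)%N.
    by apply: leq_trans ik; rewrite subnS -!subn1 leq_sub2r// leq_subr.
  have := @sel (i' k) (n - k.+1)%N (x k) (fun j => a' (k + j)%N) rn.
  have bk : box (i' k) (x k).
    apply: boxx => [|j jk]; first exact: ltnW.
    by rewrite (iE (Ordinal (ltn_trans jk kn))) (iE (Ordinal kn)); exact: ii.
  move=> /(_ bk (fun j => a'1 _)).
  rewrite addn0 -subSn//= subSS => h.
  have := IH (ltnW kn); rewrite -natr1 mulrDl mul1r => h'.
  have -> : (fun j => a' (k.+1 + j)%N) = (fun j => a' (k + j)%N) \o succn.
    by apply/funext => j; rewrite /= addnS addSn.
  have -> : x k.+1 = x k + a' k *: e (i' k) by rewrite /x big_ord_recr.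
  set p := F _ _ _ in h *; set q := F _ _ _ in h h'; set p' := F n a' 0 in h' *.
  have -> : p - p' = (q - p') + (p - q) by ring.
  rewrite (le_trans (ler_normD _ _))// lerD// (le_trans h)//.
  exact: eps_anti.
have -> : \sum_j a j *: (w \o s) (i j) = x n.
  by apply: eq_bigr => j _; rewrite aE iE.
have -> : \sum_j a j *: completion_unit iter_monotone_norm j =
    completion_trunc iter_monotone_norm n a'.
  by rewrite -sum_completion_unit; apply: eq_bigr => j _; rewrite aE.
rewrite norm_completion_trunc; have := main n (leqnn n).
rewrite subnn => /le_lt_trans; apply.
case: n {i a ni ii a1 i' a' iE aE a'1 x boxx main} => [|n]; first by rewrite mul0r exprn_gt0.
rewrite /eps /= mulrCA divff ?mulr1 ?pnatr_eq0// ltr_iXn2l ?invr_gt0 ?invf_lt1 ?ltr1n//.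
by rewrite -[n.+1]addn1 ltn_add2l.
Qed.

End spreading_subsequence.

(** * Riemann sums and jumps *)

Lemma negligible_of_small_cover d (T : measurableType d) (R : realType)
    (mu : {measure set T -> \bar R}) (A : set T) :
  (forall eps : R, 0 < eps -> exists B, [/\ measurable B, A `<=` B & (mu B <= eps%:E)%E]) ->
  mu.-negligible A.
Proof.
move=> h.
have /choice[B BP] : forall n : nat, exists B,
    [/\ measurable B, A `<=` B & (mu B <= n.+1%:R^-1%:E)%E].
  by move=> n; apply: h; rewrite invr_gt0.
have mB : measurable (\bigcap_n B n) by apply: bigcapT_measurable => n; have [] := BP n.
exists (\bigcap_n B n); split => //; last by move=> x Ax n _; have [_ + _] := BP n; apply.
apply/eqP; rewrite eq_le measure_ge0 andbT; apply/lee_addgt0Pr => eps eps0; rewrite add0e.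
have [n neps] : exists n : nat, n.+1%:R^-1 <= eps.
  exists (Num.truncn eps^-1); rewrite invf_ple ?posrE//; exact/ltW/truncnS_gt.
have [mBn _ Bn] := BP n; apply: (@le_trans _ _ (mu (B n))).
  by apply: le_measure; rewrite ?inE//; exact: bigcap_inf.
by rewrite (le_trans Bn)// lee_fin.
Qed.

Section riemann_jumps.
Context (R : realType) (E : normedModType R) (X : set E) (f : R -> E) (c : R).
Hypotheses (fX : riemann_integrable X f) (c0 : 0 < c).

(* Exchanging the tags [t] and [t'] of a cell moves a Riemann sum by a multiple
   of [f t' - f t], with either sign; [S] is the contribution of earlier cells. *)
Definition spreads_at t := forall (S : E) (delta : R), 0 < delta ->
  exists t', [/\ t' \in `[0, 1], `|t' - t| < delta &
    `|S| + c <= `|S + (f t' - f t)| \/ `|S| + c <= `|S - (f t' - f t)|].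

(** The cell is open so that every [t'] close enough to [t] stays in it. *)
Let hit (m i : nat) := `[< exists t, [/\ t \in `[0, 1], spreads_at t &
  t \in `]i%:R / m%:R, i.+1%:R / m%:R[] >].

Let cell (m : nat) (s : nat -> R) := forall i, i%:R / m%:R <= s i <= i.+1%:R / m%:R.

(** Cells are treated from left to right, with [S] the difference accumulated so far. In a hit cell
    the sign offered by [spreads_at] decides which tag sequence receives [t'] and which [t];
    elsewhere both receive the same tag. *)
Lemma spread_tags m k : exists s s', [/\ cell m s, cell m s' &
  c * \sum_(i < k) (hit m i)%:R <= `|\sum_(i < k) (f (s i) - f (s' i))|].
Proof.
have cell0 : cell m (fun i => i%:R / m%:R).
  by move=> i; rewrite lexx ler_wpM2r ?invr_ge0// ler_nat.
elim: k => [|k [s [s' [cs cs' h]]]].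
  exists (fun i => i%:R / m%:R), (fun i => i%:R / m%:R); split => //.
  by rewrite !big_ord0 mulr0.
pose upd (s : nat -> R) x i := if i == k then x else s i.
have cell_upd s1 x : cell m s1 -> k%:R / m%:R <= x <= k.+1%:R / m%:R -> cell m (upd s1 x).
  by move=> cs1 cx i; rewrite /upd; case: eqP => // ->.
have sum_upd x x' : \sum_(i < k.+1) (f (upd s x i) - f (upd s' x' i)) =
    \sum_(i < k) (f (s i) - f (s' i)) + (f x - f x').
  rewrite big_ord_recr /= /upd eqxx; congr (_ + _); apply: eq_bigr => i _.
  by rewrite ltn_eqF.
have [kh|nkh] := boolP (hit m k); last first.
  have ck := cell0 k.
  exists (upd s (k%:R / m%:R)), (upd s' (k%:R / m%:R)); split; try exact: cell_upd.
  by rewrite sum_upd subrr addr0 big_ord_recr /= (negbTE nkh) addr0.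
have /asboolP[t [t01 st]] := kh; rewrite in_itv /= => /andP[kt tk].
set S := \sum_(i < k) (f (s i) - f (s' i)) in h *.
have d0 : 0 < Num.min (t - k%:R / m%:R) (k.+1%:R / m%:R - t).
  by rewrite lt_min !subr_gt0 kt.
have [t' [t'01 + SS]] := st S _ d0; rewrite lt_min => /andP[d1 d2].
have ct : k%:R / m%:R <= t <= k.+1%:R / m%:R by rewrite !ltW.
have ct' : k%:R / m%:R <= t' <= k.+1%:R / m%:R.
  have := ler_norm (t' - t); have := ler_norm (t - t'); rewrite (distrC t t').
  by move=> h1 h2; apply/andP; split; lra.
have hS : c * \sum_(i < k.+1) (hit m i)%:R <= `|S| + c.
  by rewrite big_ord_recr /= kh mulrDr mulr1 lerD2r.
case: SS => SS.
  exists (upd s t'), (upd s' t); split; try exact: cell_upd.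
  by rewrite sum_upd (le_trans hS).
exists (upd s t), (upd s' t'); split; try exact: cell_upd.
by rewrite sum_upd (le_trans hS)// (le_trans SS)// opprB.
Qed.

Let grid (m : nat) := mkseq (fun i => i.+1%:R / m%:R : R) m.

Lemma node_grid m i : (0 < m)%N -> (i <= m)%N -> node (grid m) i = i%:R / m%:R.
Proof.
move=> m0; case: i => [|i im]; rewrite /node /=; first by rewrite mul0r.
by rewrite nth_mkseq.
Qed.

Lemma grid_tagged m s : (0 < m)%N -> cell m s -> tagged_partition (grid m) s.
Proof.
move=> m0 cs; split; last first.
  by move=> i; rewrite size_mkseq => im; rewrite !node_grid// ?cs// ltnW.
split.
  apply/(pathP 0) => i; rewrite size_mkseq => im.
  have := @node_grid m i m0 (ltnW im); rewrite /node => ->.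
  by rewrite nth_mkseq// ltr_pM2r ?invr_gt0 ?ltr0n// ltr_nat.
have := @node_grid m m m0 (leqnn m); rewrite divff ?pnatr_eq0 -?lt0n// /node => <-.
by rewrite (last_nth 0) size_mkseq.
Qed.

Lemma grid_step m (i : 'I_m) : (0 < m)%N ->
  node (grid m) i.+1 - node (grid m) i = m%:R^-1.
Proof.
by move=> m0; rewrite !node_grid// ?(ltnW (ltn_ord i))// -mulrBl -natr1 addrC addKr mul1r.
Qed.

Lemma riemann_sum_grid m s : (0 < m)%N ->
  riemann_sum f (grid m) s = m%:R^-1 *: \sum_(i < m) f (s i).
Proof.
move=> m0; rewrite /riemann_sum size_mkseq scaler_sumr; apply: eq_bigr => i _.
by rewrite grid_step.
Qed.

Lemma mesh_grid m : (0 < m)%N -> mesh (grid m) <= m%:R^-1.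
Proof.
move=> m0; rewrite /mesh size_mkseq; apply: bigmax_le => [|i _].
  by rewrite invr_ge0.
by rewrite grid_step.
Qed.

(** Two Riemann sums on a fine grid differ by at most [eps * c], whereas those of [spread_tags]
    differ by at least [c / m] times the number of hit cells. *)
Lemma few_hits eps : 0 < eps ->
  exists2 m, (0 < m)%N & \sum_(i < m) (hit m i)%:R / m%:R <= eps :> R.
Proof.
move=> eps0; have [x _ /(_ (eps * c / 2))] := fX.
rewrite divr_gt0 ?mulr_gt0// => /(_ isT)[delta delta0 H].
have [m m0 md] : exists2 m, (0 < m)%N & m%:R^-1 < delta.
  exists (Num.truncn delta^-1).+1 => //.
  by rewrite invf_plt ?posrE ?ltr0n// truncnS_gt.
exists m => //; have [s [s' [cs cs' h]]] := spread_tags m m.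
have md' := le_lt_trans (mesh_grid m0) md.
have h1 := H _ _ (grid_tagged m0 cs) md'; have h2 := H _ _ (grid_tagged m0 cs') md'.
have : `|riemann_sum f (grid m) s - riemann_sum f (grid m) s'| <= eps * c.
  rewrite -(subrK x (riemann_sum f (grid m) s)) -addrA (le_trans (ler_normD _ _))//.
  by rewrite [leRHS]splitr lerD// ltW// distrC.
rewrite !riemann_sum_grid// -scalerBr -sumrB normrZ gtr0_norm ?invr_gt0 ?ltr0n//.
rewrite -mulr_suml => h3; rewrite -(ler_pM2r c0) (le_trans _ h3)//.
by rewrite mulrC mulrA [leLHS]mulrC ler_wpM2l ?invr_ge0.
Qed.

Lemma spreads_negligible :
  lebesgue_measure.-negligible [set t | t \in `[0, 1] /\ spreads_at t].
Proof.
apply: negligible_of_small_cover => eps eps0.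
have [m m0 hm] := few_hits eps0.
pose C i : set R :=
  if hit m i then `[i%:R / m%:R, i.+1%:R / m%:R]%classic else set0.
have mC i : measurable (C i) by rewrite /C; case: ifP => _; [exact: measurable_itv|].
(* Left nodes are added since [hit] looks at open cells only; they are null. *)
pose B i : set R := [set i%:R / m%:R] `|` C i.
have mB i : measurable (B i).
  by apply: measurableU; [exact: measurable_set1|exact: mC].
(* The extra index [m] covers the point 1. *)
exists (\big[setU/set0]_(i < m.+1) B i); split.
- by apply: bigsetU_measurable => i _; exact: mB.
- move=> t [t01 st]; rewrite -bigcup_mkord.
  move: (t01); rewrite in_itv /= => /andP[t0 t1].
  have tm0 : 0 <= t * m%:R by rewrite mulr_ge0.
  have /andP[h1 h2] := truncn_itv tm0; set i := Num.truncn _ in h1 h2.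
  have M0 : 0 < m%:R :> R by rewrite ltr0n.
  exists i => /=.
    rewrite ltnS -(ler_nat R) (le_trans h1)//.
    by rewrite -[leRHS]mul1r ler_wpM2r.
  move: h1; rewrite le_eqVlt => /predU1P[h1|h1].
    by left; rewrite h1 mulfK ?gt_eqF.
  right; have it : i%:R / m%:R < t by rewrite ltr_pdivrMr.
  have ti : t < i.+1%:R / m%:R by rewrite ltr_pdivlMr.
  rewrite /C; have -> : hit m i by apply/asboolP; exists t; split => //; rewrite in_itv /= it.
  by rewrite /= in_itv /= !ltW.
have BC i : (lebesgue_measure (B i) <= lebesgue_measure (C i))%E.
  rewrite -[leRHS]add0e -(lebesgue_measure_set1 (i%:R / m%:R)).
  by apply: measureU2; [exact: measurable_set1|exact: mC].
have sub : (lebesgue_measure (\big[setU/set0]_(i < m.+1) B i) <=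
    \sum_(i < m.+1) lebesgue_measure (B i))%E.
  by apply: Boole_inequality => i _; exact: mB.
apply: (le_trans sub).
apply: (@le_trans _ _ (\sum_(i < m.+1) ((hit m i)%:R / m%:R)%:E)%E).
  apply: lee_sum => i _; apply: (le_trans (BC i)); rewrite /C; case: ifP => _; last by rewrite measure0 mul0r.
  rewrite lebesgue_measure_itv /= lte_fin; case: ifP => _; last by rewrite mul1r lee_fin.
  by rewrite -EFinB lee_fin -mulrBl -natr1 addrC addKr.
rewrite sumEFin lee_fin big_ord_recr /=.
(* The cell of index [m] lies to the right of 1, so nothing in [0, 1] hits it. *)
suff /negbTE -> : ~~ hit m m by rewrite mul0r addr0.
apply/asboolP => -[t [+ _]]; rewrite !in_itv /= divff ?pnatr_eq0 -?lt0n//.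
by move=> /andP[_ t1] /andP[/(le_lt_trans t1)]; rewrite ltxx.
Qed.

End riemann_jumps.

(** * The space L^1 of a probability measure *)

Section L1_theory.
Context d (T : measurableType d) (R : realType) (mu : {measure set T -> \bar R}).
Local Notation L1 := (LspaceType mu (@lexx _ _ 1%E)).
Local Notation itg g := (mu.-integrable setT (EFin \o g)).
Implicit Types (u v S : L1) (g h : T -> R).

Lemma integrable_measurable g : itg g -> measurable_fun setT g.
Proof. by move=> /(measurable_int mu)/measurable_EFinP. Qed.

Lemma integrable_dom g h : measurable_fun setT g -> (forall x, `|g x| <= h x) ->
  itg h -> itg g.
Proof.
move=> mg gh ih; apply: le_integrable ih => //; first exact/measurable_EFinP.
by move=> x _ /=; rewrite lee_fin (le_trans (gh x))// ler_norm.
Qed.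

Lemma integrable_add g h : itg g -> itg h -> itg (fun x => g x + h x).
Proof. by move=> ig ih; exact: integrableD ig ih. Qed.

Lemma integrable_scale (k : R) g : itg g -> itg (fun x => k * g x).
Proof. by move=> ig; exact: integrableZl ig. Qed.

Lemma integrable_sub g h : itg g -> itg h -> itg (fun x => g x - h x).
Proof. by move=> ig ih; exact: integrableB ig ih. Qed.

Lemma integrable_abs g : itg g -> itg (fun x => `|g x|).
Proof. exact: integrable_norm. Qed.

Lemma L1_integrable u : itg u.
Proof. by apply/Lfun1_integrable; exact: Lrepr_Lfun. Qed.
Hint Resolve L1_integrable : core.

Lemma ae_eq_Rintegral g h : measurable_fun setT g -> measurable_fun setT h ->
  {ae mu, forall x, g x = h x} -> \int[mu]_x g x = \int[mu]_x h x.
Proof.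
move=> mg mh gh; rewrite /Rintegral; congr fine; apply: ae_eq_integral => //.
- exact/measurable_EFinP.
- exact/measurable_EFinP.
- by apply: filterS gh => x ->.
Qed.

Lemma L1_normE u : `|u| = \int[mu]_x `|u x|.
Proof. by rewrite [LHS]/Num.norm/= /Lp_norm Lnorm1. Qed.

Lemma L1_addE u v : {ae mu, forall x, (u + v) x = u x + v x}.
Proof. by apply: filterS (Lclass_ae (Lrepr u + Lrepr v)) => x; apply. Qed.

Lemma L1_scaleE (k : R) u : {ae mu, forall x, (k *: u) x = k * u x}.
Proof. by apply: filterS (Lclass_ae (k *: Lrepr u)) => x; apply. Qed.

Lemma L1_subE u v : {ae mu, forall x, (u - v) x = u x - v x}.
Proof.
rewrite -scaleN1r; apply: filterS2 (L1_addE u (-1 *: v)) (L1_scaleE (-1) v).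
by move=> x -> ->; rewrite mulN1r.
Qed.

Lemma L1_normDE u v : `|u + v| = \int[mu]_x `|u x + v x|.
Proof.
rewrite L1_normE; apply: ae_eq_Rintegral.
- exact/integrable_measurable/integrable_abs.
- exact/integrable_measurable/integrable_abs/integrable_add.
by apply: filterS (L1_addE u v) => x ->.
Qed.

Lemma L1_normBE u v : `|u - v| = \int[mu]_x `|u x - v x|.
Proof.
rewrite L1_normE; apply: ae_eq_Rintegral.
- exact/integrable_measurable/integrable_abs.
- exact/integrable_measurable/integrable_abs/integrable_sub.
by apply: filterS (L1_subE u v) => x ->.
Qed.

Lemma le_int g h : itg g -> itg h -> (forall x, g x <= h x) ->
  \int[mu]_x g x <= \int[mu]_x h x.
Proof. by move=> ig ih gh; apply: le_Rintegral. Qed.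

(** The excess of [|g|] over [M]. Equi-integrability means that excesses over large constants have
    uniformly small integrals. *)
Definition above (M g : T -> R) x := Num.max (`|g x| - M x) 0.

Lemma integrable_above M g : itg M -> itg g -> itg (above M g).
Proof.
move=> iM ig; have iMg := integrable_sub (integrable_abs ig) iM.
apply: integrable_dom (integrable_abs iMg).
  by apply: measurable_maxr; [exact: integrable_measurable iMg|exact: measurable_cst].
by move=> x; rewrite /above; case: (leP (_ - _) 0) => _; rewrite ?normr0.
Qed.

(* |s + r| + |s - r| = 2 max(|s|, |r|) pointwise. *)
Lemma int_above_le S u (c : R) :
  `|S + u| <= `|S| + c -> `|S - u| <= `|S| + c ->
  \int[mu]_x above (fun x => `|S x|) u x <= c.
Proof.
rewrite L1_normDE L1_normBE L1_normE => h1 h2.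
have iS := integrable_abs (L1_integrable S).
have iA := integrable_above iS (L1_integrable u).
have : \int[mu]_x (2 * `|S x| + 2 * above (fun x => `|S x|) u x) <=
    \int[mu]_x (`|S x + u x| + `|S x - u x|).
  apply: le_int.
  - by apply: integrable_add; exact: integrable_scale.
  - by apply: integrable_add; apply: integrable_abs;
      [exact: integrable_add|exact: integrable_sub].
  move=> x; rewrite /above; case: (leP (_ - _) 0) => _.
    rewrite mulr0 addr0; have := ler_normD (S x + u x) (S x - u x).
    rewrite (_ : S x + u x + (S x - u x) = 2 * S x); last by ring.
    by rewrite normrM ger0_norm.
  have := ler_normB (S x + u x) (S x - u x).
  rewrite (_ : S x + u x - (S x - u x) = 2 * u x); last by ring.
  by rewrite normrM ger0_norm// => h; lra.
rewrite !RintegralD//; last 4 first.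
- by apply: integrable_abs; exact: integrable_add.
- by apply: integrable_abs; exact: integrable_sub.
- exact: integrable_scale.
- exact: integrable_scale.
rewrite !RintegralZl//; lra.
Qed.

Lemma above_trans M N g x : above N g x <= above M g x + above N M x.
Proof.
rewrite /above; have := ler_norm (M x).
by case: (leP _ 0) => h1; case: (leP _ 0) => h2; case: (leP _ 0) => h3 h4; lra.
Qed.

(** Used to pass from the threshold [|S|], a function, to a constant one. *)
Lemma int_above_trans M N g : itg M -> itg N -> itg g ->
  \int[mu]_x above N g x <= \int[mu]_x above M g x + \int[mu]_x above N M x.
Proof.
move=> iM iN ig; rewrite -RintegralD//; try exact: integrable_above.
apply: le_int; [exact: integrable_above| |by move=> x; exact: above_trans].
by apply: integrable_add; exact: integrable_above.
Qed.

Lemma above_scale (k M : R) g x : 0 <= k ->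
  above (fun=> k * M) (fun x => k * g x) x = k * above (fun=> M) g x.
Proof.
move=> k0; rewrite /above normrM ger0_norm// -mulrBr.
by rewrite maxr_pMr// mulr0.
Qed.

Hypothesis muT : mu setT = 1%E.

Lemma integrable_cst (M : R) : itg (fun=> M).
Proof.
apply: measurable_bounded_integrable => //; first by rewrite muT ltry.
by exists `|M|; split => // y My x _ /=; exact: ltW.
Qed.
Hint Resolve integrable_cst : core.

Lemma int_cst (M : R) : \int[mu]_x M = M.
Proof. by rewrite Rintegral_cst// muT mulr1. Qed.

Lemma int_above_cst g (eps : R) : itg g -> 0 < eps ->
  exists2 M : R, 0 <= M & \int[mu]_x above (fun=> M) g x <= eps.
Proof.
move=> ig eps0.
have h : (\int[mu]_x (above (fun=> n%:R) g x)%:E @[n --> \oo] --> \int[mu]_x (cst 0 x))%E.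
  apply: (@dominated_cvg _ _ _ mu setT measurableT _ _ (EFin \o (fun x => `|g x|))) => //.
  - move=> n; apply/measurable_EFinP.
    exact/integrable_measurable/integrable_above.
  - move=> x _; apply: cvg_near_cst; exists (Num.truncn `|g x|).+1 => // n /= gn.
    rewrite /above max_r// subr_le0 ltW// (lt_le_trans (truncnS_gt _))// ler_nat //.
  - exact: integrable_abs.
  move=> n x _ /=; rewrite lee_fin /above; case: (leP (_ - _) 0) => h; first by rewrite normr0.
  by rewrite ger0_norm ?(ltW h)// gerBl.
have {h} : (fine (\int[mu]_x (above (fun=> n%:R) g x)%:E)%E @[n --> \oo] --> 0).
  apply: fine_cvg; move: h; by rewrite integral_cst// mul0e.
move=> /cvgr0Pnorm_le/(_ _ eps0)[n _ /(_ n (leqnn n)) h].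
by exists n%:R => //; exact: le_trans (ler_norm _) h.
Qed.

Lemma int_above_anti (u : L1) (M N : R) : M <= N ->
  \int[mu]_x above (fun=> N) u x <= \int[mu]_x above (fun=> M) u x.
Proof.
move=> MN; apply: le_int => [||x].
- exact: integrable_above (integrable_cst N) (L1_integrable u).
- exact: integrable_above (integrable_cst M) (L1_integrable u).
by rewrite /above ge_max !le_max lerD2l lerN2 MN lexx orbT.
Qed.

Lemma int_above_scale (u : L1) (k M : R) : 0 <= k ->
  \int[mu]_x above (fun=> k * M) (k *: u) x = k * \int[mu]_x above (fun=> M) u x.
Proof.
move=> k0; have iM := integrable_above (integrable_cst M) (L1_integrable u).
rewrite -RintegralZl//; apply: ae_eq_Rintegral.
- apply: integrable_measurable.
  by apply: integrable_above; [exact: (integrable_cst)|exact: L1_integrable].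
- by apply: integrable_measurable; exact: (integrable_scale k iM).
apply: filterS (L1_scaleE k u) => x kx.
by rewrite -above_scale// /above kx.
Qed.

(** * Truncation and choice of signs *)

Definition clamp (M : R) g x := Num.max (- M) (Num.min (g x) M).

Lemma clamp_dist (M : R) g x : 0 <= M -> `|g x - clamp M g x| <= above (fun=> M) g x.
Proof.
move=> M0; rewrite /above /clamp.
have := ler_norm (g x); have := ler_norm (- g x); rewrite normrN => g1 g2.
case: (leP (`|g x| - M) 0) => h3; case: (leP (g x) M) => h1;
  [case: (leP (- M) (g x))|case: (leP (- M) M)|case: (leP (- M) (g x))|case: (leP (- M) M)] => h2.
all: rewrite ler_norml; apply/andP; split; lra.
Qed.

Lemma clamp_le (M : R) g x : 0 <= M -> `|clamp M g x| <= M.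
Proof.
move=> M0; rewrite /clamp ler_norml.
by case: (leP (g x) M) => h1; [case: (leP (- M) (g x))|case: (leP (- M) M)] => h2;
  apply/andP; split; lra.
Qed.

Lemma measurable_clamp (M : R) g : measurable_fun setT g -> measurable_fun setT (clamp M g).
Proof.
move=> mg; apply: measurable_maxr; first exact: measurable_cst.
by apply: measurable_minr => //; exact: measurable_cst.
Qed.

(** [g] is the signed sum of the clamped vectors. Signs are chosen one at a time: by the
    parallelogram identity, one of the two adds at most [M ^+ 2] to the second moment. The uniform
    bound on [g] makes its square integrable. *)
Lemma signed_sum_clamp (e : nat -> L1) (M eps : R) k : 0 <= M ->
  (forall i, (i < k)%N -> \int[mu]_x above (fun=> M) (e i) x <= eps) ->
  exists (s : nat -> R) (g : T -> R),
  [/\ forall i, `|s i| = 1, measurable_fun setT g, forall x, `|g x| <= k%:R * M,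
      \int[mu]_x (g x ^+ 2) <= k%:R * M ^+ 2 &
      \int[mu]_x `|(\sum_(i < k) s i *: e i) x - g x| <= k%:R * eps].
Proof.
move=> M0; elim: k => [|k IH] ek.
  exists (fun=> 1), (fun=> 0); split=> //.
  - by move=> i; rewrite normr1.
  - by move=> x; rewrite normr0 mul0r.
  - by under eq_Rintegral do rewrite expr0n /=; rewrite int_cst mul0r.
  rewrite big_ord0 mul0r (@ae_eq_Rintegral _ (fun=> 0)) ?int_cst//.
    by apply/integrable_measurable/integrable_abs/integrable_sub.
  apply: filterS (L1_scaleE 0 (0 : L1)) => x; rewrite scale0r => ->.
  by rewrite mul0r subr0 normr0.
have [|s [g [s1 mg gM g2 dist]]] := IH; first by move=> i ik; apply: ek; exact: ltnW.
pose c := clamp M (e k).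
have mc : measurable_fun setT c.
  exact/measurable_clamp/integrable_measurable.
have cM x : `|c x| <= M by exact: clamp_le.
have ig : itg g by apply: integrable_dom gM _.
have ic : itg c by apply: integrable_dom cM _.
have gc_le t x : `|t| = 1 -> `|g x + t * c x| <= k.+1%:R * M.
  move=> t1; rewrite (le_trans (ler_normD _ _))// -natr1 mulrDl mul1r lerD//.
  by rewrite normrM t1 mul1r.
have mgc t : measurable_fun setT (fun x => g x + t * c x).
  by apply: measurable_funD => //; apply: measurable_funM.
have sqr_le (y C : R) : `|y| <= C -> `|y ^+ 2| <= C ^+ 2.
  by move=> yC; rewrite normrX lerXn2r// nnegrE ?(le_trans _ yC).
have igc2 t : `|t| = 1 -> itg (fun x => (g x + t * c x) ^+ 2).
  move=> t1; apply: (@integrable_dom _ (fun=> (k.+1%:R * M) ^+ 2)) => //.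
    exact: measurable_funX.
  by move=> x; apply: sqr_le; exact: gc_le.
have ig2 : itg (fun x => g x ^+ 2).
  apply: (@integrable_dom _ (fun=> (k%:R * M) ^+ 2)) => //; first exact: measurable_funX.
  by move=> x; exact: sqr_le.
have ic2 : itg (fun x => c x ^+ 2).
  apply: (@integrable_dom _ (fun=> M ^+ 2)) => //; first exact: measurable_funX.
  by move=> x; exact: sqr_le.
have [t t1 ht] : exists2 t : R, `|t| = 1 &
    \int[mu]_x ((g x + t * c x) ^+ 2) <= k.+1%:R * M ^+ 2.
  have par : \int[mu]_x ((g x + 1 * c x) ^+ 2) + \int[mu]_x ((g x + -1 * c x) ^+ 2) =
      2 * \int[mu]_x (g x ^+ 2) + 2 * \int[mu]_x (c x ^+ 2).
    have i1 := igc2 1 (normr1 _); have i2 := igc2 (-1) (normrN1 _).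
    rewrite -!RintegralZl// -!RintegralD//; try exact: integrable_scale.
    by apply: eq_Rintegral => x _; ring.
  have hc : \int[mu]_x (c x ^+ 2) <= M ^+ 2.
    rewrite -[leRHS]int_cst; apply: le_int => // x.
    by rewrite (le_trans (ler_norm _))// sqr_le.
  rewrite -natr1 mulrDl mul1r.
  have [h|h] := leP (\int[mu]_x ((g x + 1 * c x) ^+ 2)) (k%:R * M ^+ 2 + M ^+ 2).
    by exists 1 => //; rewrite normr1.
  by exists (-1); [rewrite normrN1|lra].
pose s' i := if i == k then t else s i.
exists s', (fun x => g x + t * c x); split => //.
- by move=> i; rewrite /s'; case: eqP.
- by move=> x; exact: gc_le.
have -> : \sum_(i < k.+1) s' i *: e i = \sum_(i < k) s i *: e i + t *: e k.
  rewrite big_ord_recr /= {2}/s' eqxx; congr (_ + _); apply: eq_bigr => i _.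
  by rewrite /s' ltn_eqF.
set Sk := \sum_(i < k) _ in dist *.
have iA := integrable_above (integrable_cst M) (L1_integrable (e k)).
have iSg : itg (fun x => `|Sk x - g x|) by apply: integrable_abs; exact: integrable_sub.
rewrite -natr1 mulrDl mul1r; apply: le_trans (lerD dist (ek _ (ltnSn k))).
rewrite -RintegralD//.
rewrite (@ae_eq_Rintegral _ (fun x => `|(Sk x - g x) + t * (e k x - c x)|)).
- apply: le_int.
  + apply: integrable_abs; apply: integrable_add; first exact: integrable_sub.
    by apply: integrable_scale; exact: integrable_sub.
  + exact: integrable_add.
  move=> x; rewrite (le_trans (ler_normD _ _))// lerD2l normrM t1 mul1r.
  exact: clamp_dist.
- apply/integrable_measurable/integrable_abs/integrable_sub => //.
  by apply: integrable_add => //; exact: integrable_scale.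
- apply/integrable_measurable/integrable_abs/integrable_add; first exact: integrable_sub.
  by apply: integrable_scale; exact: integrable_sub.
apply: filterS2 (L1_addE Sk (t *: e k)) (L1_scaleE t (e k)) => x -> ->.
by congr (`|_|); ring.
Qed.

(** The second moment of [g] controls its L^1 norm through AM-GM, the total mass being 1. The weight
    [lam] is left free, to be taken proportional to [n]. *)
Lemma signed_sum_le (e : nat -> L1) (M eps lam : R) n : 0 <= M -> 0 < lam ->
  (forall i, (i < n)%N -> \int[mu]_x above (fun=> M) (e i) x <= eps) ->
  exists2 s : nat -> R, (forall i, `|s i| = 1) &
  `|\sum_(i < n) s i *: e i| <= n%:R * eps + (n%:R * M ^+ 2 / lam + lam) / 2.
Proof.
move=> M0 lam0 /(signed_sum_clamp M0)[s [g [s1 mg gM g2 dist]]].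
exists s => //; set S := \sum_(i < n) _ in dist *.
have ig : itg g by apply: integrable_dom gM _.
have ig2 : itg (fun x => g x ^+ 2).
  apply: (@integrable_dom _ (fun=> (n%:R * M) ^+ 2)) => //; first exact: measurable_funX.
  by move=> x; rewrite normrX lerXn2r// nnegrE ?(le_trans _ (gM x)).
pose q x := (2 * lam)^-1 * g x ^+ 2 + lam / 2.
have iq : itg q by apply: integrable_add => //; exact: integrable_scale.
have iSg : itg (fun x => `|S x - g x|) by apply: integrable_abs; exact: integrable_sub.
have : `|S| <= \int[mu]_x (`|S x - g x| + q x).
  rewrite L1_normE; apply: le_int; [exact: integrable_abs|exact: integrable_add|].
  move=> x; rewrite -{1}(subrK (g x) (S x)) (le_trans (ler_normD _ _))// lerD2l /q.
  (* AM-GM: 2 lam |g| <= g^2 + lam^2 *)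
  have := sqr_ge0 (`|g x| - lam); rewrite sqrrB real_normK ?num_real// => h.
  rewrite -(ler_pM2l (_ : 0 < 2 * lam)) ?mulr_gt0//.
  rewrite mulrDr mulrA divff ?mul1r ?gt_eqF ?mulr_gt0//.
  rewrite (_ : 2 * lam * (lam / 2) = lam ^+ 2); last by field.
  by rewrite -subr_ge0 (le_trans h)// le_eqVlt; apply/orP; left; apply/eqP; ring.
have -> : \int[mu]_x (`|S x - g x| + q x) =
    \int[mu]_x `|S x - g x| + ((2 * lam)^-1 * \int[mu]_x (g x ^+ 2) + lam / 2).
  rewrite RintegralD//; congr (_ + _); rewrite RintegralD//; last exact: integrable_scale.
  by congr (_ + _); [exact: RintegralZl|exact: int_cst].
move=> /le_trans; apply; rewrite lerD// [leRHS]mulrDl lerD//.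
rewrite (_ : n%:R * M ^+ 2 / lam / 2 = (2 * lam)^-1 * (n%:R * M ^+ 2)); last first.
  by field; rewrite gt_eqF.
by rewrite ler_wpM2l// invr_ge0 mulr_ge0// ltW.
Qed.

(** * Functionals given by integration against signs *)

Definition sign_on (B : set T) x : R := if x \in B then 1 else -1.

Lemma norm_sign_on B x : `|sign_on B x| = 1.
Proof. by rewrite /sign_on; case: ifP; rewrite ?normrN ?normr1. Qed.

Lemma measurable_sign_on B : measurable B -> measurable_fun setT (sign_on B).
Proof.
move=> mB; rewrite (_ : sign_on B = fun x => 2 * \1_B x - 1).
  apply: measurable_funB; last exact: measurable_cst.
  by apply: measurable_funM; [exact: measurable_cst|exact: measurable_indic].
apply/funext => x; rewrite /sign_on indicE.
by case: (x \in B); rewrite ?mulr1 ?mulr0 ?sub0r//; lra.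
Qed.

Definition pairing (B : set T) u := \int[mu]_x (sign_on B x * u x).

Lemma integrable_pairing B g : measurable B -> itg g -> itg (fun x => sign_on B x * g x).
Proof.
move=> mB ig; apply: integrable_dom (integrable_abs ig).
  apply: measurable_funM; first exact: measurable_sign_on.
  exact: integrable_measurable.
by move=> x; rewrite normrM norm_sign_on mul1r.
Qed.

Lemma pairingD B u v : measurable B -> pairing B (u + v) = pairing B u + pairing B v.
Proof.
move=> mB; rewrite /pairing -RintegralD//; try exact: integrable_pairing.
apply: ae_eq_Rintegral.
- exact/integrable_measurable/integrable_pairing.
- by apply/integrable_measurable/integrable_add; exact: integrable_pairing.
by apply: filterS (L1_addE u v) => x ->; rewrite mulrDr.
Qed.

Lemma pairingZ B (k : R) u : measurable B -> pairing B (k *: u) = k * pairing B u.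
Proof.
move=> mB; rewrite /pairing -RintegralZl//; try exact: integrable_pairing.
apply: ae_eq_Rintegral.
- exact/integrable_measurable/integrable_pairing.
- by apply/integrable_measurable/integrable_scale; exact: integrable_pairing.
by apply: filterS (L1_scaleE k u) => x ->; rewrite mulrCA.
Qed.

Lemma pairing_le B u : measurable B -> `|pairing B u| <= `|u|.
Proof.
move=> mB; rewrite L1_normE /pairing (le_trans (le_normr_Rintegral _ _))//.
  exact: integrable_pairing.
apply: le_int; [exact/integrable_abs/integrable_pairing|exact: integrable_abs|].
by move=> x; rewrite normrM norm_sign_on mul1r.
Qed.

(** For [A] the set where [u >= 0], pairing with the sign of [A] gives the norm. Replacing [A] by
    [B] changes signs on the symmetric difference only, where [|u|] is at most [M] plus its
    excess. *)
Lemma pairing_almost_norm u (eps : R) : 0 < eps -> exists2 delta : R, 0 < delta &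
  exists2 A : set T, measurable A & forall B, measurable B ->
  (mu ((A `\` B) `|` (B `\` A)) <= delta%:E)%E -> `|u| - eps <= pairing B u.
Proof.
move=> eps0.
have [|M M0 hM] := @int_above_cst u (eps / 4) (L1_integrable u).
  by rewrite divr_gt0.
(* Chosen so that [2 * M * delta <= eps / 2]; the added 1 covers [M = 0]. *)
exists (eps / (4 * (M + 1))); first by rewrite divr_gt0// mulr_gt0// ltr_wpDl.
pose A := [set x | 0 <= u x].
have mA : measurable A.
  have mu' := integrable_measurable (L1_integrable u).
  have := mu' measurableT `[0, +oo[%classic (measurable_itv _).
  rewrite setTI; suff -> : u @^-1` `[0, +oo[%classic = A by [].
  by apply/seteqP; split => x /=; rewrite in_itv /= andbT.
exists A => // B mB hB; set C := (_ `|` _) in hB.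
have mC : measurable C by apply: measurableU; exact: measurableD.
have iC : itg (\1_C : T -> R).
  apply: (@integrable_dom _ (fun=> 1)) => // x.
  by rewrite indicE; case: (_ \in _); rewrite ?normr1 ?normr0.
have iA := integrable_above (integrable_cst M) (L1_integrable u).
have : \int[mu]_x `|u x| <= \int[mu]_x (sign_on B x * u x +
    (2 * M * \1_C x + 2 * above (fun=> M) u x)).
  apply: le_int.
  - exact: integrable_abs.
  - apply: integrable_add; first exact: integrable_pairing.
    by apply: integrable_add; exact: integrable_scale.
  move=> x; rewrite indicE.
  have a0 : 0 <= above (fun=> M) u x by rewrite /above le_max lexx orbT.
  have a1 : `|u x| - M <= above (fun=> M) u x by rewrite /above le_max lexx.
  have c1 : x \in C -> sign_on B x * u x + 2 * `|u x| >= `|u x|.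
    move=> _; have := ler_norm (- (sign_on B x * u x)).
    rewrite normrN normrM norm_sign_on mul1r; lra.
  have c0 : x \notin C -> sign_on B x * u x = `|u x|.
    rewrite notin_setE => nC; rewrite /sign_on; case: ifPn => [|].
      rewrite inE => Bx; rewrite mul1r ger0_norm//.
      by apply: contrapT => Ax; apply: nC; right.
    rewrite notin_setE => Bx; rewrite mulN1r ltr0_norm// ltNge.
    by apply/negP => Ax; apply: nC; left.
  case: (boolP (x \in C)) => [/c1|/c0] h; rewrite /= ?mulr1 ?mulr0; lra.
rewrite RintegralD//; last 2 first.
- exact: integrable_pairing.
- by apply: integrable_add; exact: integrable_scale.
rewrite RintegralD//; last 2 first.
- exact: integrable_scale.
- exact: integrable_scale.
rewrite !RintegralZl// -/(pairing B u) -L1_normE.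
have -> : \int[mu]_x \1_C x = fine (mu C).
  by rewrite /Rintegral integral_indic// setIT.
have : fine (mu C) <= eps / (4 * (M + 1)).
  rewrite -lee_fin fineK// ge0_fin_numE//.
  by apply: le_lt_trans hB _; rewrite ltry.
move=> /(ler_wpM2l M0); rewrite (_ : M * (eps / (4 * (M + 1))) = eps / 4 * (M / (M + 1))).
  have : M / (M + 1) <= 1 by rewrite ler_pdivrMr ?mul1r ?lerDl// ltr_wpDl.
  move=> /(ler_wpM2l (ltW (divr_gt0 eps0 (ltr0n R 4)))); lra.
by field; rewrite gt_eqF// ltr_wpDl.
Qed.

End L1_theory.

(** * Continuity almost everywhere *)

Lemma riemann_integrable_comp (R : realType) (E F : normedModType R) (X : set E)
    (f : R -> E) (phi : E -> F) :
  (forall x y, phi (x + y) = phi x + phi y) ->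
  (forall (k : R) x, phi (k *: x) = k *: phi x) -> (forall x, `|phi x| <= `|x|) ->
  riemann_integrable X f -> riemann_integrable setT (phi \o f).
Proof.
move=> phiD phiZ phi1 [x _ fx]; exists (phi x) => // eps eps0.
have [delta delta0 H] := fx _ eps0; exists delta => // s t st sd.
suff -> : riemann_sum (phi \o f) s t = phi (riemann_sum f s t).
  have -> : phi x - phi (riemann_sum f s t) = phi (x - riemann_sum f s t).
    by rewrite -[in RHS]scaleN1r phiD phiZ scaleN1r.
  exact: le_lt_trans (phi1 _) (H _ _ st sd).
have phi0 : phi 0 = 0 by rewrite -(scale0r (0 : E)) phiZ scale0r.
rewrite /riemann_sum (big_morph phi phiD phi0).
by apply: eq_bigr => i _; rewrite phiZ.
Qed.

Lemma not_spreads_at (R : realType) (E : normedModType R) (f : R -> E) (c t : R) :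
  ~ spreads_at f c t -> exists S : E, exists2 delta : R, 0 < delta &
  forall y, y \in `[0, 1] -> `|y - t| < delta ->
    `|S + (f y - f t)| < `|S| + c /\ `|S - (f y - f t)| < `|S| + c.
Proof.
move=> /existsNP[S] /existsNP[delta] /not_implyP[delta0 h].
exists S, delta => // y y01 yt; split; rewrite ltNge; apply/negP => Sy; apply: h.
  by exists y; split => //; left.
by exists y; split => //; right.
Qed.

(** On the line, one of [s + p] and [s - p] has absolute value [|s| + |p|]; so goodness of a scalar
    function makes its increments small. *)
Lemma norm_lt_of_add_sub (R : realType) (s p c : R) :
  `|s + p| < `|s| + c -> `|s - p| < `|s| + c -> `|p| < c.
Proof.
rewrite !ltr_norml => /andP[a1 a2] /andP[b1 b2].
by case: (ger0P s) a1 a2 b1 b2 => ? ? ? ? ?; apply/andP; split; lra.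
Qed.

Section discontinuity.
Context d (T : measurableType d) (R : realType) (mu : {measure set T -> \bar R}).
Hypothesis muT : mu setT = 1%E.
Local Notation L1 := (LspaceType mu (@lexx _ _ 1%E) : normedModType R).
Context (I : countType) (W : I -> set T).
Hypothesis mW : forall i, measurable (W i).
Hypothesis denseW : forall (A : set T) (eps : R), measurable A -> 0 < eps ->
  exists i, (mu ((A `\` W i) `|` (W i `\` A)) <= eps%:E)%E.

(* The coefficients +-1 make spreading models of equi-integrable sequences
   type 2 up to a small error, so they contain no l1^n uniformly. *)
Lemma spreading_model_not_ell1 (V : completeNormedModType R) (e : nat -> L1)
    (v : nat -> V) (M : nat -> R) : (forall m, 0 <= M m) ->
  (forall n m, (m <= n)%N -> \int[mu]_x above (fun=> M m) (e n) x <= m.+1%:R^-1) ->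
  generates_spreading_model e v -> ~ equivalent_sequences v (@ell1_unit R).
Proof.
move=> M0 eM [delta [delta0 deltaD _ deltaP]] [C C0 equiv].
have [m hm] : exists m : nat, m.+1%:R^-1 <= (8 * C)^-1 :> R.
  exists (Num.truncn (8 * C)); rewrite lef_pV2 ?posrE ?mulr_gt0//.
  exact/ltW/truncnS_gt.
(* Equivalence with the l^1 basis will force [3 / 4 * n] below
   [2 * C ^+ 2 * M m ^+ 2 + C * delta 0], which is [B / 8]; any [n] above [B] contradicts this. *)
pose B := 16 * C ^+ 2 * M m ^+ 2 + 8 * C * delta 0%N.
pose n := (Num.truncn B).+1.
have Bn : B < n%:R by exact: truncnS_gt.
have n0 : 0 < n%:R :> R by rewrite ltr0n.
(* Terms from [N] on are admissible for [n]-tuples and satisfy the [m]-th integrability bound. *)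
pose N := maxn n m.
(* This weight turns [lam / 2] into [n / (8 * C)] and leaves the second-moment term independent of
   [n]. *)
have lam0 : 0 < n%:R / (4 * C) :> R by rewrite divr_gt0// mulr_gt0.
have [|s s1 hs] := @signed_sum_le _ _ _ mu muT (fun i => e (N + i)%N) (M m)
    m.+1%:R^-1 _ n (M0 m) lam0.
  by move=> i _; apply: eM; rewrite (leq_trans (leq_maxr n m))// leq_addr.
have := deltaP n (fun j : 'I_n => (N + j)%N) (fun j : 'I_n => s j).
have Nj (j : 'I_n) : (n <= (N + j).+1)%N.
  by rewrite ltnW// ltnS (leq_trans (leq_maxl n m))// leq_addr.
have homo_N : {homo (fun j : 'I_n => (N + j)%N) : j k / (j < k)%N}.
  by move=> j k jk; rewrite ltn_add2l.
have s_le1 (j : 'I_n) : `|s j| <= 1 by rewrite s1.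
move=> /(_ Nj homo_N s_le1).
have [+ _] := equiv n s; rewrite ell1_unit_norm.
have -> : \sum_(i < n) `|s i| = n%:R.
  by under eq_bigr do rewrite s1; rewrite sumr_const card_ord.
have dn : delta n <= delta 0%N by apply: deltaD.
set x := \sum_(j < n) s j *: e (N + j)%N in hs *.
set y := \sum_(i < n) s i *: v i.
move=> h1; rewrite ltr_norml => /andP[h2 _].
have hx : `|x| <= n%:R * (8 * C)^-1 + (4 * C * M m ^+ 2 + n%:R / (4 * C)) / 2.
  apply: (le_trans hs); rewrite lerD// ?ler_wpM2l//.
  rewrite (_ : n%:R * M m ^+ 2 / (n%:R / (4 * C)) = 4 * C * M m ^+ 2)//.
  by field; rewrite !gt_eqF.
have : C * (C^-1 * n%:R) < C * (`|x| + delta 0%N).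
  by rewrite ltr_pM2l//; apply: (le_lt_trans h1); lra.
rewrite mulrA divff ?gt_eqF// mul1r.
have : C * `|x| <= n%:R / 4 + 2 * C ^+ 2 * M m ^+ 2.
  apply: (le_trans (ler_wpM2l (ltW C0) hx)); rewrite le_eqVlt; apply/orP; left.
  by apply/eqP; field; rewrite gt_eqF.
move: Bn; rewrite /B.
have := mulr_gt0 C0 (delta0 0%N); set cd := C * delta 0%N.
rewrite -(mulrA 8) -/cd mulrDr -/cd -(mulrA 16) -(mulrA 2); set cm := C ^+ 2 * M m ^+ 2.
have cm0 : 0 <= cm by rewrite mulr_ge0// sqr_ge0.
lra.
Qed.

Context (X : set L1) (linearX : submod_closed [in X])
  (spreadingX : forall (V : completeNormedModType R) (v : nat -> V),
    spreading_model X v -> equivalent_sequences v (@ell1_unit R)).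
Context (f : R -> L1) (fX : forall x, x \in `[0, 1] -> X (f x)).
Context (t : R) (t01 : t \in `[0, 1]).
Hypothesis ft : forall k : nat, ~ spreads_at f k.+1%:R^-1 t.
Hypothesis ft_pairing : forall i (k : nat),
  ~ spreads_at (fun x => pairing (W i) (f x) : R^o) k.+1%:R^-1 t.

(** Otherwise an ultrafilter [U] converging to [t] carries [|f y - f t| >= eps]. Goodness makes the
    normalized increments [w] equi-integrable and transversal along [U], and they yield a forbidden
    spreading model. *)
Lemma continuous_of_not_spreads : f y @[y --> within `[0, 1] (nbhs t)] --> f t.
Proof.
apply/cvgrPdist_lt => eps eps0; apply: contrapT => notcont.
pose B := [set y : R | y \in `[0, 1] /\ eps <= `|f y - f t|].
have PG : ProperFilter (within B (nbhs t)).
  have WF : Filter (within B (nbhs t)) by exact: within_filter.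
  split=> // G0; apply: notcont.
  have N0 : nbhs t [set y | ~ B y] by apply: filterS G0.
  suff : nbhs t [set y | y \in `[0, 1] -> `|f t - f y| < eps] by [].
  apply: filterS N0 => y /= By y01; rewrite ltNge; apply/negP => fy.
  by apply: By; split => //; rewrite distrC.
have [U [UF GU]] := ultraFilterLemma PG.
have UB : U B by apply: GU; exact: withinT.
have Unear delta : 0 < delta -> U [set y | `|y - t| < delta].
  move=> delta0; apply: GU.
  suff : nbhs t [set y | B y -> `|y - t| < delta] by [].
  by apply: filterS (nbhsx_ballx t delta delta0) => y; rewrite /ball /= distrC.
pose u y := f y - f t; pose w y := `|u y|^-1 *: u y.
have w1 : \forall y \near U, `|w y| = 1.
  apply: filterS UB => y [_ uy]; have u0 : `|u y| != 0 by rewrite gt_eqF// (lt_le_trans eps0).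
  by rewrite normrZ normfV normr_id mulVf.
(* Where [u y] vanishes, the inverse of 0 being 0 makes [w y] vanish too. *)
have w_le1 y : `|w y| <= 1.
  rewrite normrZ normfV normr_id; have [->|u0] := eqVneq (`|u y|) 0.
    by rewrite mulr0.
  by rewrite mulVf.
(* The scalar increments tend to 0, and normalization divides them by at least [eps]. *)
have pairing_small i (eta : R) : 0 < eta -> \forall y \near U, `|pairing (W i) (w y)| <= eta.
  move=> eta0; pose k := Num.truncn (eps * eta)^-1.
  have [S [delta delta0 H]] := not_spreads_at (@ft_pairing i k).
  apply: filterS2 UB (Unear _ delta0) => y [y01 uy] yt.
  have [] := H y y01 yt.
  have -> : pairing (W i) (f y) - pairing (W i) (f t) = pairing (W i) (u y).
    by rewrite /u -[in RHS]scaleN1r pairingD// pairingZ// mulN1r.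
  set p := pairing _ _ => h1 h2.
  have pk : `|p| < k.+1%:R^-1 by exact: norm_lt_of_add_sub h1 h2.
  have kle : k.+1%:R^-1 <= eps * eta.
    by rewrite invf_ple ?posrE ?mulr_gt0//; exact/ltW/truncnS_gt.
  have u0 : 0 < `|u y| by rewrite (lt_le_trans eps0).
  rewrite pairingZ// -/p normrM normfV normr_id ler_pdivrMl//.
  rewrite (le_trans (ltW pk))// (le_trans kle)// ler_wpM2r// ltW//.
(* Some [W i] almost norms [x], and its functional is almost 0 on [w y]; each approximation costs
   [eta / 2]. *)
have lsc (x : L1) (k eta : R) : 0 < eta ->
    \forall y \near U, `|x| - eta <= `|x + k *: w y|.
  move=> eta0; have [|delta delta0 [A mA hA]] := pairing_almost_norm muT x (_ : 0 < eta / 2).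
    by rewrite divr_gt0.
  have [i /(hA _ (mW i)) hi] := denseW mA delta0.
  have k0 : 0 < `|k| + 1 by rewrite ltr_wpDl.
  have d0 : 0 < eta / (2 * (`|k| + 1)) by rewrite divr_gt0// mulr_gt0.
  apply: filterS (pairing_small i _ d0) => y hy.
  apply: le_trans (pairing_le _ (mW i)); apply: le_trans (ler_norm _).
  rewrite pairingD// pairingZ//.
  have : `|k * pairing (W i) (w y)| <= eta / 2.
    rewrite normrM (le_trans (ler_wpM2l (normr_ge0 k) hy))//.
    rewrite (_ : `|k| * _ = eta / 2 * (`|k| / (`|k| + 1))); last by field; rewrite gt_eqF.
    by rewrite ler_piMr ?divr_ge0// ?ltW// ltr_pdivrMr// mul1r ltrDl.
  rewrite ler_norml => /andP[+ _]; lra.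
(* Goodness bounds the mean excess of [u y] over [|S|] by [c], and that of [|S|] over a constant [M]
   is at most [c]. Division by [|u y| >= eps] turns [2 * c] into the required bound and the
   threshold into at most [eps^-1 * M]. *)
have /choice[M MP] : forall m : nat, exists M : R, 0 <= M /\
    \forall y \near U, \int[mu]_x above (fun=> M) (w y) x <= m.+1%:R^-1.
  move=> m; pose c := eps / (2 * m.+1%:R).
  have c0 : 0 < c by rewrite divr_gt0// mulr_gt0.
  have [S [delta delta0 H]] := not_spreads_at (@ft (Num.truncn c^-1)).
  have kle : (Num.truncn c^-1).+1%:R^-1 <= c.
    by rewrite invf_ple ?posrE//; exact/ltW/truncnS_gt.
  have [M M0 MS] := int_above_cst muT (integrable_abs (L1_integrable S)) c0.
  exists (eps^-1 * M); split; first by rewrite mulr_ge0// invr_ge0 ltW.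
  apply: filterS2 UB (Unear _ delta0) => y [y01 uy] yt.
  have [h1 h2] := H y y01 yt.
  have := int_above_le (ltW h1) (ltW h2) => h3.
  have := int_above_trans (integrable_abs (L1_integrable S)) (integrable_cst muT M)
    (L1_integrable (u y)) => h4.
  have u0 : 0 < `|u y| by rewrite (lt_le_trans eps0).
  apply: (@le_trans _ _ (\int[mu]_x above (fun=> `|u y|^-1 * M) (w y) x)).
    apply: int_above_anti => //; rewrite ler_wpM2r// lef_pV2 ?posrE//.
  rewrite int_above_scale ?invr_ge0// ler_pdivrMl//.
  apply: (@le_trans _ _ (eps * m.+1%:R^-1)); last by rewrite ler_wpM2r ?invr_ge0.
  apply: (le_trans h4); apply: (le_trans (lerD (le_trans h3 kle) MS)).
  by rewrite le_eqVlt; apply/orP; left; apply/eqP; rewrite /c; field; rewrite ?nat1r ?natr1 pnatr_eq0.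
(* The [n]-th choice meets the bounds of index 0 to [n], so that bound [m] holds for all terms from
   [m] on. *)
pose P n y := y \in `[0, 1] /\
  forall m : 'I_n.+1, \int[mu]_x above (fun=> M m) (w y) x <= m.+1%:R^-1.
have nearP n : \forall y \near U, P n y.
  have h : \forall y \near U, forall m : 'I_n.+1,
      \int[mu]_x above (fun=> M m) (w y) x <= m.+1%:R^-1.
    by apply: filter_forall => m; have [] := MP m.
  by apply: filterS2 UB h => y [].
have [s [sP s1 s_basic s_gen]] := spreading_subsequence w1 w_le1 lsc nearP.
have X0 : 0 \in [in X] by have [] := linearX.
have wX y : y \in `[0, 1] -> X (w y).
  move=> y01; have [_ Xlin] := linearX.
  have Xu : u y \in [in X].
    rewrite /u addrC -scaleN1r; apply: Xlin; rewrite !inE; exact: fX.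
  have := Xlin (`|u y|^-1) _ _ Xu X0; rewrite addr0 !inE; exact.
apply: (spreading_model_not_ell1 (fun m => (MP m).1) _ s_gen).
  by move=> n m mn; have [_ /(_ (Ordinal (mn : (m < n.+1)%N)))] := sP n.
apply: spreadingX; split.
- exact: completion_unit_normalized.
- exact: completion_unit_basis.
exists (w \o s); split => // i; apply: wX; exact: (sP i).1.
Qed.

End discontinuity.

(** * Finite unions of rational intervals, a countable dense family of sets *)

Section rational_intervals.
Context (R : realType).

Definition rational_itv (i : rat * rat) : set R := `]ratr i.1, ratr i.2[%classic.

Definition rational_union (l : seq (rat * rat)) : set (measurableTypeR R) :=
  \big[setU/set0]_(i <- l) rational_itv i.

Lemma measurable_rational_union l : measurable (rational_union l).
Proof. by apply: bigsetU_measurable => i _; exact: measurable_itv. Qed.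

Lemma rational_unionP l x :
  rational_union l x <-> exists2 i, i \in l & rational_itv i x.
Proof.
rewrite /rational_union; elim: l => [|i l IH].
  by rewrite big_nil; split => // -[].
rewrite big_cons; split => [[ix|/IH[j jl jx]]|[j]].
- by exists i; rewrite ?mem_head.
- by exists j; rewrite // inE jl orbT.
- by rewrite inE => /predU1P[->|jl] jx; [left|right; apply/IH; exists j].
Qed.

Lemma rational_union_between (K O : set R) : compact K -> open O -> K `<=` O ->
  exists l, K `<=` rational_union l /\ rational_union l `<=` O.
Proof.
rewrite compact_cover => cK oO KO.
have [||D DO KD] := cK _ [set i | rational_itv i `<=` O] rational_itv.
- by move=> i _; exact: itv_open.
- move=> x Kx; have /nbhs_ballP[e /= e0 eO] : nbhs x O.
    by apply: open_nbhs_nbhs; split => //; exact: KO.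
  have xe : x - e < x by rewrite gtrBl.
  have ex : x < x + e by rewrite ltrDl.
  have [p] := rat_in_itvoo xe.
  rewrite in_itv /= => /andP[p1 p2].
  have [q] := rat_in_itvoo ex.
  rewrite in_itv /= => /andP[q1 q2].
  exists (p, q) => /=; last by rewrite /rational_itv /= in_itv /= p2.
  move=> y; rewrite /rational_itv /= in_itv /= => /andP[py yq]; apply: eO.
  by rewrite /ball /= ltr_norml; apply/andP; split; lra.
exists (finmap.enum_fset D); split => x.
  by move=> /KD[i /= iD ix]; apply/rational_unionP; exists i.
move=> /rational_unionP[i iD]; have := DO _ iD; rewrite inE; exact.
Qed.

Lemma lebesgue01_setT : lebesgue01 R setT = 1%E.
Proof.
rewrite /lebesgue01 /= /mrestr setTI lebesgue_measure_itv /= lte_fin ltr01.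
by rewrite oppr0 adde0.
Qed.

(** By regularity [A'] lies between a compact [K] and an open [G], each within [eps / 2] in measure.
    A rational union squeezed between them differs from [A'] only inside [G] minus [K]. *)
Lemma rational_union_dense (A : set (measurableTypeR R)) (eps : R) :
  measurable A -> 0 < eps -> exists l,
  (lebesgue01 R ((A `\` rational_union l) `|` (rational_union l `\` A)) <= eps%:E)%E.
Proof.
move=> mA eps0; pose A' := A `&` `[0, 1]%classic.
have mU : measurable (`[0, 1]%classic : set R) by exact: measurable_itv.
have mA' : measurable A' by exact: measurableI.
have A'fin : (lebesgue_measure A' < +oo)%E.
  apply: (@le_lt_trans _ _ (lebesgue_measure (`[0, 1]%classic : set R))).
    by apply: le_measure; rewrite ?inE//; exact: subIsetr.
  by rewrite lebesgue_measure_itv /= lte_fin ltr01 -EFinB ltry.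
have e20 : 0 < eps / 2 by rewrite divr_gt0.
have [K [cK KA' hK]] := lebesgue_regularity_inner mA' A'fin e20.
have [G [oG A'G hG]] := lebesgue_regularity_outer mA' A'fin e20.
have [l [Kl lG]] := rational_union_between cK oG (subset_trans KA' A'G).
exists l; have mW := measurable_rational_union l.
have mK : measurable K by apply: closed_measurable; exact: compact_closed.
have mG : measurable G by exact: open_measurable.
apply: (@le_trans _ _ (lebesgue_measure ((A' `\` K) `|` (G `\` A')))).
  apply: le_measure; rewrite ?inE.
  - by apply: measurableI => //; apply: measurableU; exact: measurableD.
  - by apply: measurableU; exact: measurableD.
  move=> x [[[Ax Wx]|[Wx Ax]] x01].
    by left; split => // Kx; apply: Wx; exact: Kl.
  by right; split; [exact: lG|case].
apply: (le_trans (measureU2 _ _ _)); [exact: measurableD|exact: measurableD|].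
by rewrite [eps]splitr EFinD; apply: leeD; exact: ltW.
Qed.

End rational_intervals.

(** * Collecting the countably many exceptional null sets *)

Theorem theorem5p1 (R : realType) (X : set (L1_01 R))
    (linearX : submod_closed [in X]) (closedX : closed X)
    (spreadingX : forall (V : completeNormedModType R) (v : nat -> V),
       spreading_model X v -> equivalent_sequences v (@ell1_unit R)) :
  lebesgue_property X.
Proof.
move=> f fX f_int.
pose bad k := [set t | t \in `[0, 1] /\ spreads_at f k.+1%:R^-1 t].
pose pair l (x : R) : R^o := pairing (@rational_union R l) (f x).
(* Lists are coded by integers so that the union runs over [nat]; an integer coding no list stands
   for the empty union. *)
pose bad_pairing (j k : nat) := [set t | t \in `[0, 1] /\
  spreads_at (pair (odflt [::] (unpickle j))) k.+1%:R^-1 t].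
have inv_gt0 k : 0 < k.+1%:R^-1 :> R by rewrite invr_gt0.
have bad0 k : lebesgue_measure.-negligible (bad k).
  exact: spreads_negligible f_int (inv_gt0 k).
have pairing_int l : riemann_integrable setT (pair l).
  have mW := @measurable_rational_union R l.
  apply: riemann_integrable_comp f_int => *.
  - exact: pairingD.
  - exact: pairingZ.
  - exact: pairing_le.
have bad_pairing0 j k : lebesgue_measure.-negligible (bad_pairing j k).
  exact: spreads_negligible (pairing_int _) (inv_gt0 k).
have : lebesgue_measure.-negligible
    (\bigcup_k bad k `|` \bigcup_j \bigcup_k bad_pairing j k).
  apply: negligibleU; first exact: negligible_bigcup.
  by apply: negligible_bigcup => j; exact: negligible_bigcup.
apply: negligibleS => t /= /not_implyP[t01 notcont].
apply: contrapT => /not_orP[nb nbp]; apply: notcont.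
apply: (@continuous_of_not_spreads _ _ R _ (lebesgue01_setT R) _ (@rational_union R)
  (@measurable_rational_union R) (@rational_union_dense R) X linearX spreadingX f fX t t01).
- by move=> k sk; apply: nb; exists k.
- move=> l k sk; apply: nbp; exists (pickle l) => //; exists k => //.
  by rewrite /bad_pairing pickleK.
Qed.
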